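(* Let $(Q,w)$ be a non-degenerate quiver with potential, $k$ a vertex of $Q$, $(Q',w')=\mu_k(Q,w)$, and assume that $J(Q,w)$ and $J(Q',w')$ are finite dimensional. Let $\mathcal{A}=\mathrm{mod}\,J(Q,w)$ and $\mathcal{A}'=\mathrm{mod}\,J(Q',w')$, with simple modules $S_1,\dots,S_n$ and $S'_1,\dots,S'_n$ respectively, and let $F_k^+:\mathcal{A}\to\mathcal{A}'$ be the generalized reflection functor. Let $N_1,N_2,\dots,N_m$ be a complete forward hom-orthogonal sequence in $\mathcal{A}$ with $N_1=S_k$. If there are two vectors $\alpha,\beta\in\mathbb{R}^n$ such that $B_k^T\beta\in\mathbb{R}^n_{>0}$ and $$\frac{\langle\alpha,N_2\rangle}{\langle\beta,N_2\rangle}<\cdots<\frac{\langle\alpha,N_m\rangle}{\langle\beta,N_m\rangle}<\frac{\langle\alpha,N_1\rangle}{\langle\beta,N_1\rangle},$$ then the maximal green sequence in $\mathcal{A}'$ corresponding to the complete forward hom-orthogonal sequence $F_k^+(N_2),\dots,F_k^+(N_m),S'_k$ can be induced by the central charge $Z:K_0(\mathcal{A}')\to\mathbb{C}$ given by $$Z(X)=\langle B_k^T\alpha,[X]\rangle+\mathrm{i}\,\langle B_k^T\beta,[X]\rangle.$$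
   Context: Quivers have finitely many vertices and arrows. Quivers with potential, mutations $\mu_k$, non-degeneracy and Jacobian algebras are in the sense of Derksen–Weyman–Zelevinsky: a potential $w$ is a (possibly infinite) linear combination of cycles in the completed path algebra of $Q$ over a field $K$, $J(Q,w)$ is the quotient of the completed path algebra by the closure of the ideal generated by the cyclic derivatives of $w$, $\mu_k(Q,w)$ is the reduced part of the premutation at $k$, and $(Q,w)$ is non-degenerate if every iterated mutation has no 2-cycles. Modules are finitely generated; $S_i,S'_i$ are the simples at vertex $i$. $[X]\in\mathbb{Z}^n$ is the class of $X$ in the Grothendieck group in the basis of simples ($[S_i]$ for $\mathcal{A}$, $[S'_i]$ for $\mathcal{A}'$), i.e. its dimension vector $\underline{\dim}X$; $\langle\theta,X\rangle=\langle\theta,[X]\rangle$ is the canonical inner product on $\mathbb{R}^n$. The matrix $B_k=(b_{ij})$ is given by $b_{ii}=1$ for $i\ne k$, $b_{kk}=-1$, $b_{kj}=$ the number of arrows from $k$ to $j$ in $Q$ for $j\ne k$, and all other entries $0$. In particular $B_k^2=I$. For a module $N$, $N^{\perp}=\{X:\mathrm{Hom}(N,X)=0\}$, ${}^{\perp}N=\{X:\mathrm{Hom}(X,N)=0\}$, $\mathcal{G}(N)={}^{\perp}(N^{\perp})=\{X:\mathrm{Hom}(X,Y)=0\ \forall Y\in N^{\perp}\}$; $\langle S_k\rangle$ (resp. $\langle S'_k\rangle$) is the full subcategory of direct sums of copies of $S_k$ (resp. $S'_k$). Generalized reflection functors: by results of Buan–Iyama–Reiten–Smith and Mou there are additive functors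 $F_k^+:\mathcal{A}\to\mathcal{A}'$ and $F_k^-:\mathcal{A}'\to\mathcal{A}$ such that: (1) $F_k^+$ is right exact, $F_k^-$ is left exact, and they are adjoint to each other; (2) $F_k^+(\langle S_k\rangle)=0$, $F_k^-(\langle S'_k\rangle)=0$; (3) $F_k^+(S_k^{\perp})\subset{}^{\perp}S'_k$, $F_k^-({}^{\perp}S'_k)\subset S_k^{\perp}$; (4) the restrictions $F_k^+:S_k^{\perp}\to{}^{\perp}S'_k$ and $F_k^-:{}^{\perp}S'_k\to S_k^{\perp}$ are inverse equivalences preserving short exact sequences; (5) if $V\in S_k^{\perp}$, then $\underline{\dim}F_k^+V=B_k\,\underline{\dim}V$. A brick is an object whose endomorphism ring is a division ring. A complete forward hom-orthogonal (CFHO) sequence in an abelian length category $\mathcal{B}$ is a finite sequence of bricks $N_1,\dots,N_m$ such that (i) $\mathrm{Hom}(N_i,N_j)=0$ for $i<j$; (ii) no other bricks of $\mathcal{G}(N)$, $N=N_1\oplus\cdots\oplus N_m$, can be inserted into the sequence (at any position) preserving (i); (iii) $\mathcal{G}(N)=\mathcal{B}$. When $N_1,\dots,N_m$ is a CFHO sequence in $\mathcal{A}$ with $N_1=S_k$, the sequence $F_k^+(N_2),\dots,F_k^+(N_m),S'_k$ is a CFHO sequence in $\mathcal{A}'$. A torsion class is a full subcategory closed under isomorphisms, extensions and factors; $\mathcal{T}\lessdot\mathcal{T}'$ means $\mathcal{T}\subsetneq\mathcal{T}'$ are torsion classes with none strictly between. A maximal green sequence in $\mathcal{B}$ is a finite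 sequence of torsion classes $0=\mathcal{T}_0\lessdot\cdots\lessdot\mathcal{T}_m=\mathcal{B}$. The one corresponding to a CFHO sequence $M_1,\dots,M_m$ is $\mathcal{T}_i=Filt(M_1,\dots,M_i)$ (objects with a finite filtration whose subquotients are isomorphic to members of $\{M_1,\dots,M_i\}$), $\mathcal{T}_0=0$. A central charge on $\mathcal{B}$ (with $n$ simples) is an additive map $Z:K_0(\mathcal{B})\to\mathbb{C}$, $Z(X)=\langle a,[X]\rangle+\mathrm{i}\langle b,[X]\rangle$ with $a\in\mathbb{R}^n$, $b\in\mathbb{R}^n_{>0}$. It determines the stability function $\phi_Z(X)=\arg Z(X)/\pi\in[0,1]$ on nonzero objects. A nonzero $M$ is semistable if $\phi_Z(L)\le\phi_Z(M)$ for all nontrivial subobjects $L\subset M$; each nonzero $X$ has a unique filtration $0=X_0\subsetneq\cdots\subsetneq X_l=X$ with semistable quotients $F_j=X_j/X_{j-1}$ and $\phi_Z(F_1)>\cdots>\phi_Z(F_l)$, and $F_l$ is the maximally destabilizing quotient of $X$. For $r\in[0,1]$, $\mathcal{T}_{\ge r}$ consists of $0$ and the nonzero $X$ whose maximally destabilizing quotient has $\phi_Z$-value $\ge r$; these are torsion classes. A maximal green sequence $(\mathcal{T}_i)$ is induced by $Z$ if $\{\mathcal{T}_{\ge r}:r\in[0,1]\}=\{\mathcal{T}_0,\dots,\mathcal{T}_m\}$. *)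

(* Defs.v *)
From HB Require Import structures.
From mathcomp Require Import all_boot all_order all_algebra.
From mathcomp Require Import boolp classical_sets functions.
From mathcomp Require Import reals trigo complex.

Set Implicit Arguments.
Unset Strict Implicit.
Unset Printing Implicit Defensive.

Import Order.TTheory GRing.Theory Num.Theory.
Import Quotient.

Local Open Scope ring_scope.
Local Open Scope quotient_scope.

Record quiver (n : nat) := Quiver {
  arrow : finType;
  src : arrow -> 'I_n;
  tgt : arrow -> 'I_n }.

Section Paths.
Variables (n : nat) (Q : quiver n).
Implicit Types (a b : arrow Q) (s : seq (arrow Q)) (i k : 'I_n).

Definition loop_free := forall a, src a != tgt a.

Definition two_acyclic := forall a b, ~~ ((src a == tgt b) && (tgt a == src b)).

Definition two_acyclic_at k :=
  forall a b, src a = k -> tgt b = k -> tgt a != src b.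

(* The pair (i, [:: a_1; ...; a_d]) stands for the path a_1 ... a_d, composed
   from right to left: a_d comes first, the path ends at i = tgt a_1, and
   (i, [::]) is the trivial path at i. *)
Definition word := ('I_n * seq (arrow Q))%type.

Fixpoint path_from i s : bool :=
  if s is a :: s' then (tgt a == i) && path_from (src a) s' else true.

Definition is_path (x : word) := path_from x.1 x.2.

Definition origin i s : 'I_n := last i (map (@src n Q) s).

Definition is_cycle (x : word) :=
  [&& is_path x, x.2 != [::] & origin x.1 x.2 == x.1].

(* a_1 a_2 ... a_d |-> a_2 ... a_d a_1 *)
Definition rotate (x : word) : word := (origin x.1 (take 1 x.2), rot 1 x.2).

Definition qpath := {x : word | is_path x}.

Lemma path_from_cat i s t :
  path_from i (s ++ t) = path_from i s && path_from (origin i s) t.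
Proof. by elim: s i => //= a s IH i; rewrite IH andbA. Qed.

Lemma origin_cat i s t : origin i (s ++ t) = origin (origin i s) t.
Proof. by rewrite /origin map_cat last_cat. Qed.

End Paths.

(* Possibly infinite linear combinations of paths. *)
Definition cpa (K : fieldType) (n : nat) (Q : quiver n) := qpath Q -> K^o.

HB.instance Definition _ (K : fieldType) (n : nat) (Q : quiver n) :=
  GRing.Lmodule.copy (cpa K Q) (qpath Q -> K^o).

Lemma sum_triangle (V : nmodType) (m : nat) (F : nat -> nat -> V) :
  \sum_(0 <= l < m) \sum_(l <= j < m) F l j =
  \sum_(0 <= j < m) \sum_(0 <= l < j.+1) F l j.
Proof.
elim: m => [|m IH]; first by rewrite !big_geq.
rewrite [RHS]big_nat_recr //= -IH [X in _ + X]big_nat_recr //=.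
rewrite [LHS]big_nat_recr //= big_nat1 addrA; congr (_ + _).
rewrite -big_split; apply: eq_big_nat => l /andP[_ lm] /=.
by rewrite big_nat_recr // ltnW.
Qed.

Section CompletedPathAlgebra.
Variables (K : fieldType) (n : nat) (Q : quiver n).
Implicit Types (u v w : cpa K Q) (p : qpath Q) (x : word Q).

(* The coefficient of u at x, which is 0 when the word x is not a path. *)
Definition coef u x : K := if insub x is Some p then u p else 0.

Definition monom x : cpa K Q := fun p => (val p == x)%:R.

Definition vertex (i : 'I_n) : cpa K Q := monom (i, [::]).

Definition arrow_elt (a : arrow Q) : cpa K Q := monom (tgt a, [:: a]).

Definition cpa_one : cpa K Q := fun p => ((val p).2 == [::])%:R.

Definition cpa_mul u v : cpa K Q := fun p =>
  let: (i, s) := val p in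
  \sum_(0 <= j < (size s).+1)
     coef u (i, take j s) * coef v (origin i (take j s), drop j s).

Lemma cpa_ext u v : (forall x, is_path x -> coef u x = coef v x) -> u = v.
Proof.
move=> uv; apply/funext => p; have := uv (val p) (valP p).
by rewrite /coef valK.
Qed.

Lemma coef_out u x : ~~ is_path x -> coef u x = 0.
Proof. by move=> xP; rewrite /coef insubN. Qed.

Lemma coefD u v x : coef (u + v) x = coef u x + coef v x.
Proof. by rewrite /coef; case: insub => //; rewrite addr0. Qed.

Lemma coefZ c u x : coef (c *: u) x = c * coef u x.
Proof. by rewrite /coef; case: insub => //; rewrite mulr0. Qed.

Lemma coef_monom y x : is_path x -> coef (monom y) x = (x == y)%:R.
Proof. by move=> xP; rewrite /coef insubT. Qed.

Lemma coef_one x : is_path x -> coef cpa_one x = (x.2 == [::])%:R.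
Proof. by move=> xP; rewrite /coef insubT. Qed.

Lemma coef_mul u v i s : coef (cpa_mul u v) (i, s) =
  \sum_(0 <= j < (size s).+1)
     coef u (i, take j s) * coef v (origin i (take j s), drop j s).
Proof.
have [sP|sNP] := boolP (is_path (i, s)).
  by rewrite [in LHS]/coef insubT.
rewrite coef_out // big1_seq // => j _.
have [uP|/coef_out->] := boolP (is_path (i, take j s)); last by rewrite mul0r.
rewrite (@coef_out v) ?mulr0 //; apply: contra sNP => vP.
have: path_from i (take j s ++ drop j s) by rewrite path_from_cat; apply/andP.
by rewrite cat_take_drop.
Qed.

Lemma cpa_mulA : associative cpa_mul.
Proof.
move=> u v w; apply: cpa_ext => -[i s] _; rewrite !coef_mul.
pose F (l j : nat) := coef u (i, take l s) *
  coef v (origin i (take l s), take (j - l) (drop l s)) *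
  coef w (origin i (take j s), drop j s).
transitivity (\sum_(0 <= l < (size s).+1) \sum_(l <= j < (size s).+1) F l j).
  apply: eq_big_nat => l /andP[_ ls]; rewrite coef_mul mulr_sumr size_drop.
  rewrite -[in RHS](add0n l) big_addn subSn //.
  apply: eq_big_nat => j _; rewrite /F mulrA addnK -origin_cat drop_drop.
  by rewrite -takeD (addnC l).
rewrite sum_triangle; apply: eq_big_nat => j /andP[_ js].
rewrite coef_mul mulr_suml size_takel //.
apply: eq_big_nat => l /andP[_ lj]; rewrite /F take_takel //.
by rewrite take_drop subnK.
Qed.

Lemma cpa_1mul : left_id cpa_one cpa_mul.
Proof.
move=> u; apply: cpa_ext => -[i s] sP; rewrite coef_mul big_nat_recl //=.
rewrite take0 drop0 coef_one //= mul1r big1_seq ?addr0 // => j /andP[_].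
rewrite mem_index_iota => /= js.
have [tP|/coef_out->] := boolP (is_path (i, take j.+1 s)); last by rewrite mul0r.
by rewrite coef_one //= -size_eq0 size_takel // mul0r.
Qed.

Lemma cpa_mul1 : right_id cpa_one cpa_mul.
Proof.
move=> u; apply: cpa_ext => -[i s] sP; rewrite coef_mul big_nat_recr //=.
rewrite take_size drop_size coef_one //= mulr1 big1_seq ?add0r // => j /andP[_].
rewrite mem_index_iota => /= js.
have [tP|/coef_out->] := boolP (is_path (origin i (take j s), drop j s));
  last by rewrite mulr0.
by rewrite coef_one //= -size_eq0 size_drop subn_eq0 leqNgt js mulr0.
Qed.

Lemma cpa_mulDl : left_distributive cpa_mul +%R.
Proof.
move=> u v w; apply: cpa_ext => -[i s] _; rewrite coefD !coef_mul -big_split.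
by apply: eq_bigr => j _; rewrite coefD mulrDl.
Qed.

Lemma cpa_mulDr : right_distributive cpa_mul +%R.
Proof.
move=> u v w; apply: cpa_ext => -[i s] _; rewrite coefD !coef_mul -big_split.
by apply: eq_bigr => j _; rewrite coefD mulrDr.
Qed.

End CompletedPathAlgebra.

Arguments monom K {n Q} x.
Arguments vertex K {n} Q i.
Arguments arrow_elt K {n Q} a.

HB.instance Definition _ (K : fieldType) (n : nat) (Q : quiver n) :=
  GRing.Zmodule_isPzRing.Build (cpa K Q)
    (@cpa_mulA K n Q) (@cpa_1mul K n Q) (@cpa_mul1 K n Q)
    (@cpa_mulDl K n Q) (@cpa_mulDr K n Q).

Section Potentials.
Variables (K : fieldType) (n : nat) (Q : quiver n).
Implicit Types (u v w : cpa K Q) (S : set (cpa K Q)).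

Definition agree_below (d : nat) u v :=
  forall p : qpath Q, (size (val p).2 < d)%N -> u p = v p.

(* Closure in the m-adic topology, m being the arrow ideal; m ^ d consists of
   the combinations of paths of length at least d. *)
Definition adic_closure S : set (cpa K Q) :=
  [set u | forall d, exists2 v, S v & agree_below d u v].

Definition cyclic u := forall p : qpath Q, u p != 0 -> is_cycle (val p).

Definition rotation_span : set (cpa K Q) :=
  [set u | exists2 r : seq (K * word Q), all (fun t => is_cycle t.2) r
     & u = \sum_(t <- r) t.1 *: (monom K t.2 - monom K (rotate t.2))].

Definition cyclically_equivalent u v := adic_closure rotation_span (u - v).

(* d_a (a_1 ... a_d) is the sum over a_k = a of a_(k+1) ... a_d a_1 ... a_(k-1),
   so that a path q gets the coefficients in w of the cycles q2 a q1
   with q1 q2 = q. *)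
Definition cyclic_derivative (a : arrow Q) w : cpa K Q := fun p =>
  let: (i, s) := val p in
  \sum_(0 <= j < (size s).+1)
     coef w (origin i (take j s), drop j s ++ a :: take j s).

Definition jacobian_generated w : set (cpa K Q) :=
  [set u | exists r : seq (cpa K Q * arrow Q * cpa K Q),
     u = \sum_(t <- r) t.1.1 * cyclic_derivative t.1.2 w * t.2].

Definition jacobian_ideal w : {pred cpa K Q} :=
  fun u => `[< adic_closure (jacobian_generated w) u >].

Lemma agree_belowM d u u' v v' :
  agree_below d u u' -> agree_below d v v' -> agree_below d (u * v) (u' * v').
Proof.
move=> uu vv p pd; rewrite /GRing.mul /= /cpa_mul; case: (val p) pd => i s /= sd.
apply: eq_big_nat => j /andP[_ js]; congr (_ * _); rewrite /coef.
  by case: insubP => //= q _ qE; rewrite uu //= qE /= size_takel // (leq_ltn_trans _ sd).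
by case: insubP => //= q _ qE; rewrite vv //= qE /= size_drop (leq_ltn_trans (leq_subr _ _)).
Qed.

Lemma jacobian_generatedB w u v :
  jacobian_generated w u -> jacobian_generated w v -> jacobian_generated w (u - v).
Proof.
move=> [r ->] [t ->]; exists (r ++ [seq (- x.1.1, x.1.2, x.2) | x <- t]).
rewrite big_cat /= big_map -sumrN; congr (_ + _).
by apply: eq_bigr => x _ /=; rewrite !mulNr.
Qed.

Lemma jacobian_generatedM w x u y :
  jacobian_generated w u -> jacobian_generated w (x * u * y).
Proof.
move=> [r ->]; exists [seq (x * t.1.1, t.1.2, t.2 * y) | t <- r].
rewrite big_map mulr_sumr mulr_suml.
by apply: eq_bigr => t _ /=; rewrite !mulrA.
Qed.

Lemma scale_cpaE (c : K) u : c *: u = (c *: (1 : cpa K Q)) * u.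
Proof.
apply: cpa_ext => -[i s] sP; rewrite coefZ coef_mul big_nat_recl //=.
rewrite take0 drop0 coefZ coef_one //= mulr1 big1_seq ?addr0 // => j /andP[_].
rewrite mem_index_iota => /= js; rewrite coefZ.
have [tP|/coef_out->] := boolP (is_path (i, take j.+1 s));
  last by rewrite mulr0 mul0r.
by rewrite coef_one //= -size_eq0 size_takel // mulr0 mul0r.
Qed.

Lemma jacobian_ideal_zmod w : zmod_closed (jacobian_ideal w).
Proof.
split=> [|u v /asboolP uI /asboolP vI]; apply/asboolP => d.
  by exists 0 => //; exists [::]; rewrite big_nil.
have [[u' uI' uu'] [v' vI' vv']] := (uI d, vI d).
exists (u' - v'); first exact: jacobian_generatedB.
by move=> p pd; rewrite !fctE uu' // vv'.
Qed.

Lemma jacobian_idealM w x u y :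
  u \in jacobian_ideal w -> x * u * y \in jacobian_ideal w.
Proof.
move=> /asboolP uI; apply/asboolP => d; have [v vI uv] := uI d.
exists (x * v * y); first exact: jacobian_generatedM.
by apply: agree_belowM => //; apply: agree_belowM.
Qed.

HB.instance Definition _ w :=
  GRing.isZmodClosed.Build (cpa K Q) (jacobian_ideal w) (jacobian_ideal_zmod w).

End Potentials.

(* Cyclic equivalence is not built into potentials, nor are potentials
   normalized to contain at most one cycle of each rotation class. *)
Record qpot (K : fieldType) (n : nat) := QPot {
  qp_quiver :> quiver n;
  qp_pot : cpa K qp_quiver;
  qp_loop_free : loop_free qp_quiver;
  qp_cyclic : cyclic qp_pot }.

Arguments qp_pot {K n} q.
Arguments qp_loop_free {K n} q.
Arguments qp_cyclic {K n} q.

Definition jacobian (K : fieldType) (n : nat) (P : qpot K n) :=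
  {quot jacobian_ideal (qp_pot P)}.

HB.instance Definition _ (K : fieldType) (n : nat) (P : qpot K n) :=
  GRing.Zmodule.on (jacobian P).
HB.instance Definition _ (K : fieldType) (n : nat) (P : qpot K n) :=
  EqQuotient.on (jacobian P).

Section JacobianAlgebra.
Variables (K : fieldType) (n : nat) (P : qpot K n).
Notation J := (jacobian P).
Notation A := (cpa K P).

Definition jac_pi (u : A) : J := \pi u.

Definition jac_one : J := jac_pi 1.
Definition jac_mul (x y : J) : J := jac_pi (repr x * repr y).
Definition jac_scale (c : K) (x : J) : J := jac_pi (c *: repr x).

Lemma jac_piP (u v : A) :
  reflect (jac_pi u = jac_pi v) (u - v \in jacobian_ideal (qp_pot P)).
Proof. by rewrite Quotient.idealrBE; apply: eqP. Qed.

Lemma jac_reprK x : jac_pi (repr x) = x.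
Proof. exact: reprK. Qed.

Lemma jac_pi_repr (u : A) : repr (jac_pi u) - u \in jacobian_ideal (qp_pot P).
Proof. by apply/jac_piP; rewrite jac_reprK. Qed.

Lemma jac_piD : {morph jac_pi : u v / u + v}.
Proof. exact: raddfD. Qed.

Lemma jac_piM (u v : A) : jac_pi (u * v) = jac_mul (jac_pi u) (jac_pi v).
Proof.
apply/esym/jac_piP.
rewrite -[X in X - _](subrK (u * repr (jac_pi v))) -mulrBl -addrA -mulrBr.
apply: rpredD; last by rewrite -[X in X \in _]mulr1; apply/jacobian_idealM/jac_pi_repr.
by rewrite -[X in X * _]mul1r; apply/jacobian_idealM/jac_pi_repr.
Qed.

Lemma jac_piZ c (u : A) : jac_pi (c *: u) = jac_scale c (jac_pi u).
Proof.
apply/esym/jac_piP; rewrite -scalerBr scale_cpaE -[X in X \in _]mulr1.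
exact/jacobian_idealM/jac_pi_repr.
Qed.

Lemma jac_mulA : associative jac_mul.
Proof.
move=> x y z; rewrite -(jac_reprK x) -(jac_reprK y) -(jac_reprK z).
by rewrite -!jac_piM mulrA.
Qed.

Lemma jac_1mul : left_id jac_one jac_mul.
Proof. by move=> x; rewrite -(jac_reprK x) -jac_piM mul1r. Qed.

Lemma jac_mul1 : right_id jac_one jac_mul.
Proof. by move=> x; rewrite -(jac_reprK x) -jac_piM mulr1. Qed.

Lemma jac_mulDl : left_distributive jac_mul +%R.
Proof.
move=> x y z; rewrite -(jac_reprK x) -(jac_reprK y) -(jac_reprK z).
by rewrite -jac_piD -!jac_piM mulrDl jac_piD.
Qed.

Lemma jac_mulDr : right_distributive jac_mul +%R.
Proof.
move=> x y z; rewrite -(jac_reprK x) -(jac_reprK y) -(jac_reprK z).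
by rewrite -jac_piD -!jac_piM mulrDr jac_piD.
Qed.

HB.instance Definition _ := GRing.Zmodule_isPzRing.Build J
  jac_mulA jac_1mul jac_mul1 jac_mulDl jac_mulDr.

Lemma jac_scaleA a b x : jac_scale a (jac_scale b x) = jac_scale (a * b) x.
Proof. by rewrite -(jac_reprK x) -!jac_piZ scalerA. Qed.

Lemma jac_scale1 : left_id 1 jac_scale.
Proof. by move=> x; rewrite -(jac_reprK x) -jac_piZ scale1r. Qed.

Lemma jac_scaleDr : right_distributive jac_scale +%R.
Proof.
move=> c x y; rewrite -(jac_reprK x) -(jac_reprK y).
by rewrite -jac_piD -!jac_piZ scalerDr jac_piD.
Qed.

Lemma jac_scaleDl x : {morph jac_scale^~ x : a b / a + b}.
Proof. by move=> a b; rewrite -(jac_reprK x) -!jac_piZ scalerDl jac_piD. Qed.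

HB.instance Definition _ := GRing.Zmodule_isLmodule.Build K J
  jac_scaleA jac_scale1 jac_scaleDr jac_scaleDl.

Definition finite_dimensional :=
  exists b : seq J, forall x : J,
    exists c : nat -> K, x = \sum_(0 <= i < size b) c i *: b`_i.

End JacobianAlgebra.

Section Mutation.
Variables (K : fieldType) (n : nat).

Definition right_equivalent (Q : quiver n) (w : cpa K Q)
    (Q' : quiver n) (w' : cpa K Q') :=
  exists phi : {linear cpa K Q -> cpa K Q'},
    [/\ bijective phi, {morph phi : u v / u * v},
        forall i, phi (vertex K Q i) = vertex K Q' i
      & cyclically_equivalent (phi w) w'].

(* Arrows of the premutation at k: an arrow of Q not incident to k, a composite
   [ab] with src a = k = tgt b, or a reversed arrow a^* for a incident to k. *)
Section Premutation.
Variables (k : 'I_n) (Q : quiver n).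

Definition mut_raw := (arrow Q + arrow Q * arrow Q + arrow Q)%type.
Definition Keep a : mut_raw := inl (inl a).
Definition Comp a b : mut_raw := inl (inr (a, b)).
Definition Star a : mut_raw := inr a.

Definition mut_ok (x : mut_raw) : bool :=
  match x with
  | inl (inl a) => (src a != k) && (tgt a != k)
  | inl (inr (a, b)) => (src a == k) && (tgt b == k)
  | inr a => (src a == k) || (tgt a == k)
  end.

Definition mut_src (x : mut_raw) : 'I_n :=
  match x with
  | inl (inl a) => src a | inl (inr (a, b)) => src b | inr a => tgt a
  end.

Definition mut_tgt (x : mut_raw) : 'I_n :=
  match x with
  | inl (inl a) => tgt a | inl (inr (a, b)) => tgt a | inr a => src a
  end.

Definition premut_quiver : quiver n :=
  @Quiver n {x : mut_raw | mut_ok x}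
    (fun x => mut_src (val x)) (fun x => mut_tgt (val x)).

Definition is_star (x : mut_raw) : bool := if x is inr _ then true else false.

Definition unbracket (x : mut_raw) : seq (arrow Q) :=
  match x with
  | inl (inl a) => [:: a] | inl (inr (a, b)) => [:: a; b] | inr _ => [::]
  end.

(* [w]: every factor ab through k of a cycle of w is replaced with [ab]. This is
   a bijection from the paths of Q that neither start nor end at k to the paths
   of the premutation outside k with no starred arrow. *)
Definition bracket (w : cpa K Q) : cpa K premut_quiver := fun p =>
  let: (i, s) := val p in
  let xs := map val s in
  if has is_star xs then 0 else coef w (i, flatten (map unbracket xs)).

Definition triangles : cpa K premut_quiver := fun p =>
  \sum_(a | src a == k) \sum_(b | tgt b == k)
     (map val (val p).2 == [:: Comp a b; Star b; Star a])%:R.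

Definition premut_pot (w : cpa K Q) := bracket w + triangles.

End Premutation.

Arguments premut_pot k {Q} w.

Section DirectSum.
Variables (Q C : quiver n) (w : cpa K Q) (t : cpa K C).

Definition sum_quiver : quiver n :=
  @Quiver n (arrow Q + arrow C)%type
    (fun x => match x with inl a => src a | inr c => src c end)
    (fun x => match x with inl a => tgt a | inr c => tgt c end).

(* l = s, up to the embedding of arrows, as soon as both have the same size. *)
Definition sum_pot : cpa K sum_quiver := fun p =>
  let: (i, s) := val p in
  let l := pmap (fun x : arrow Q + arrow C => if x is inl a then Some a else None) s in
  let r := pmap (fun x : arrow Q + arrow C => if x is inr c then Some c else None) s in
  (if size l == size s then coef w (i, l) else 0) +
  (if size r == size s then coef t (i, r) else 0).

End DirectSum.

Definition homogeneous (d : nat) (Q : quiver n) (u : cpa K Q) :=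
  forall p : qpath Q, u p != 0 -> size (val p).2 = d.

Definition trivial_qp (C : qpot K n) :=
  homogeneous 2 (qp_pot C) /\
  forall a : arrow C, exists c : arrow C -> K,
    arrow_elt K a = \sum_b c b *: cyclic_derivative b (qp_pot C).

Definition reduced_qp (P : qpot K n) :=
  forall p : qpath P, (size (val p).2 < 3)%N -> qp_pot P p = 0.

(* mu_k (P) is only determined up to right equivalence. *)
Definition is_mutation (k : 'I_n) (P P' : qpot K n) :=
  [/\ two_acyclic_at P k, reduced_qp P' &
      exists w : cpa K P,
        [/\ cyclic w, cyclically_equivalent (qp_pot P) w,
            forall p : qpath P, (val p).1 = k -> w p = 0 &
            exists2 C : qpot K n, trivial_qp C &
              right_equivalent (premut_pot k w)
                (sum_pot (qp_pot P') (qp_pot C))]].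

Inductive iterated_mutation (P : qpot K n) : qpot K n -> Prop :=
| iterated_refl : iterated_mutation P P
| iterated_step k P' P'' : iterated_mutation P P' -> is_mutation k P' P'' ->
    iterated_mutation P P''.

Definition nondegenerate_qp (P : qpot K n) :=
  forall P', iterated_mutation P P' -> two_acyclic P'.

End Mutation.

Section Modules.
Variables (K : fieldType) (n : nat) (P : qpot K n).
Notation J := (jacobian P).

(* A left J-module of finite dimension over K; when J is finite dimensional these
   are the finitely generated ones. By the order of composition of paths, an
   arrow a acts as a linear map from e_(src a) M to e_(tgt a) M. *)
Record jmod := JMod {
  car :> vectType K;
  jact : {linear J -> 'End(car)};
  jact1 : jact 1 = \1%VF;
  jactM : forall x y : J, jact (x * y) = (jact x \o jact y)%VF }.

Definition is_jhom (M N : jmod) : {pred 'Hom(M, N)} :=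
  fun f => `[< forall x : J, (f \o jact M x)%VF = (jact N x \o f)%VF >].

Lemma is_jhom_zmod M N : zmod_closed (@is_jhom M N).
Proof.
split=> [|f g /asboolP fP /asboolP gP]; apply/asboolP => x.
  by rewrite comp_lfun0l comp_lfun0r.
by rewrite comp_lfunDl comp_lfunDr comp_lfunNl comp_lfunNr fP gP.
Qed.

HB.instance Definition _ (M N : jmod) :=
  GRing.isZmodClosed.Build 'Hom(M, N) (@is_jhom M N) (@is_jhom_zmod M N).

Record jhom (M N : jmod) := JHom {
  jhom_val :> 'Hom(M, N);
  jhomP : jhom_val \in @is_jhom M N }.

HB.instance Definition _ (M N : jmod) := [isSub for @jhom_val M N].
HB.instance Definition _ (M N : jmod) := [Choice of jhom M N by <:].
HB.instance Definition _ (M N : jmod) := [SubChoice_isSubZmodule of jhom M N by <:].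

Lemma jid_subproof M : \1%VF \in @is_jhom M M.
Proof. by apply/asboolP => x; rewrite comp_lfun1l comp_lfun1r. Qed.
Definition jid M : jhom M M := JHom (jid_subproof M).

Lemma jcomp_subproof M N L (g : jhom N L) (f : jhom M N) :
  (g \o f)%VF \in @is_jhom M L.
Proof.
apply/asboolP => x; have [/asboolP fP /asboolP gP] := (jhomP f, jhomP g).
by rewrite -comp_lfunA fP comp_lfunA gP comp_lfunA.
Qed.
Definition jcomp M N L (g : jhom N L) (f : jhom M N) : jhom M L :=
  JHom (jcomp_subproof g f).

Definition is_iso M N (f : jhom M N) :=
  exists g : jhom N M, jcomp g f = jid M /\ jcomp f g = jid N.

Definition iso M N := exists f : jhom M N, is_iso f.

Definition is_zero (M : jmod) := \dim {:M} = 0%N.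

Definition hom_zero (M N : jmod) := forall f : jhom M N, f = 0.

Definition monic M N (f : jhom M N) := lker f == 0%VS.
Definition epic M N (f : jhom M N) := limg f == fullv.
Definition exact_at M N L (f : jhom M N) (g : jhom N L) := limg f == lker g.
Definition short_exact M N L (f : jhom M N) (g : jhom N L) :=
  [/\ monic f, exact_at f g & epic g].

Definition brick (M : jmod) :=
  jid M <> 0 /\ forall f : jhom M M, f <> 0 -> is_iso f.

(* dim (e_i M) *)
Definition dim_vector (M : jmod) : 'cV[int]_n :=
  \col_i (\dim (limg (jact M (jac_pi (vertex K P i)))))%:Z.

Lemma coef_jacobian_ideal (u : cpa K P) i :
  u \in jacobian_ideal (qp_pot P) -> coef u (i, [::]) = 0.
Proof.
move=> /asboolP /(_ 1%N)[_ [r ->] uv].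
have coef1 (v v' : cpa K P) : coef (v * v') (i, [::]) =
    coef v (i, [::]) * coef v' (i, [::]).
  by rewrite coef_mul big_nat1.
have -> : coef u (i, [::]) = coef (\sum_(t <- r)
    t.1.1 * cyclic_derivative t.1.2 (qp_pot P) * t.2) (i, [::]).
  by rewrite /coef insubT; apply: uv.
elim: r {uv} => [|t r IH]; first by rewrite big_nil /coef insubT.
rewrite big_cons coefD IH addr0 !coef1.
have -> : coef (cyclic_derivative t.1.2 (qp_pot P)) (i, [::]) = 0.
  rewrite /coef insubT /cyclic_derivative /= big_nat1 /= /coef.
  case: insubP => // p _ pE.
  have [->//|/(qp_cyclic P)] := eqVneq (qp_pot P p) 0.
  rewrite pE /is_cycle /is_path /origin /= andbT => /andP[/eqP<- /eqP st].
  by have := qp_loop_free P t.1.2; rewrite st eqxx.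
by rewrite mulr0 mul0r.
Qed.

(* The simple module at vertex i: K, on which paths of positive length act
   as 0. *)
Definition simple_act i (x : J) : 'End(K^o) := coef (repr x) (i, [::]) *: \1%VF.

Lemma coef_repr (u : cpa K P) i :
  coef (repr (jac_pi u)) (i, [::]) = coef u (i, [::]).
Proof.
have := coef_jacobian_ideal i (jac_pi_repr u).
by rewrite coefD -scaleN1r coefZ mulN1r => /eqP; rewrite subr_eq0 => /eqP.
Qed.

Lemma simple_act_linear i : linear (simple_act i).
Proof.
move=> c x y; rewrite -(jac_reprK x) -(jac_reprK y).
rewrite -[c *: _]jac_piZ -jac_piD /simple_act !coef_repr coefD coefZ.
by rewrite scalerDl scalerA.
Qed.

HB.instance Definition _ i :=
  GRing.isLinear.Build K J 'End(K^o) *:%R (simple_act i) (simple_act_linear i).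

Lemma simple_act1 i : simple_act i 1 = \1%VF.
Proof. by rewrite /simple_act coef_repr coef_one //= scale1r. Qed.

Lemma simple_actM i (x y : J) :
  simple_act i (x * y) = (simple_act i x \o simple_act i y)%VF.
Proof.
rewrite -(jac_reprK x) -(jac_reprK y) -[_ * _]jac_piM /simple_act !coef_repr.
by rewrite coef_mul big_nat1 /= -comp_lfunZl -comp_lfunZr comp_lfun1l scalerA.
Qed.

Definition simple i : jmod := JMod (simple_act1 i) (@simple_actM i).

Definition zero_act (x : J) : 'End('rV[K]_0) := 0.
Lemma zero_act_linear : linear zero_act.
Proof. by move=> c x y; rewrite /zero_act scaler0 addr0. Qed.
HB.instance Definition _ :=
  GRing.isLinear.Build K J 'End('rV[K]_0) *:%R zero_act zero_act_linear.
Lemma zero_act1 : zero_act 1 = \1%VF.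
Proof. by apply/lfunP => v; apply/rowP; case. Qed.
Lemma zero_actM (x y : J) : zero_act (x * y) = (zero_act x \o zero_act y)%VF.
Proof. by rewrite /zero_act comp_lfun0l. Qed.
Definition zero_mod : jmod := JMod zero_act1 zero_actM.

Section BinarySum.
Variables M N : jmod.

Definition sum_fun (x : J) (v : M * N) : M * N := (jact M x v.1, jact N x v.2).
Lemma sum_fun_linear x : linear (sum_fun x).
Proof. by move=> c u v; rewrite /sum_fun /= !linearP. Qed.
HB.instance Definition _ x :=
  GRing.isLinear.Build K (M * N)%type (M * N)%type *:%R (sum_fun x)
    (sum_fun_linear x).

Definition sum_act (x : J) : 'End((M * N)%type) := linfun (sum_fun x).
Lemma sum_act_linear : linear sum_act.
Proof.
move=> c x y; apply/lfunP => v; rewrite !lfunE /= !lfunE /= lfunE /=.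
by rewrite /sum_fun !linearP !lfunE /= !lfunE.
Qed.
HB.instance Definition _ :=
  GRing.isLinear.Build K J 'End((M * N)%type) *:%R sum_act sum_act_linear.
Lemma sum_act1 : sum_act 1 = \1%VF.
Proof. by apply/lfunP => -[u v]; rewrite !lfunE /= /sum_fun !jact1 !lfunE. Qed.
Lemma sum_actM (x y : J) : sum_act (x * y) = (sum_act x \o sum_act y)%VF.
Proof.
apply/lfunP => v; rewrite lfunE /= lfunE /= !lfunE /= /sum_fun /= !jactM.
by rewrite !lfunE.
Qed.
Definition sum_mod : jmod := JMod sum_act1 sum_actM.

End BinarySum.

Definition direct_sum (Ns : seq jmod) : jmod := foldr sum_mod zero_mod Ns.

End Modules.

Section TorsionTheory.
Variables (K : fieldType) (n : nat) (P : qpot K n).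
Notation mod := (jmod P).

(* Full subcategories. The universe of [set] is too small for jmod P. *)
Definition subcat := mod -> Prop.

Implicit Types (M N X Y : mod) (Ns : seq mod) (T : subcat).

Definition subcat_eq T T' := forall X, T X <-> T' X.
Definition subcat_proper T T' := (forall X, T X -> T' X) /\ ~ subcat_eq T T'.

Definition nth_mod Ns i := nth (zero_mod P) Ns i.

Definition right_perp N : subcat := fun X => hom_zero N X.
Definition left_perp N : subcat := fun X => hom_zero X N.
Definition gen_by N : subcat :=
  fun X => forall Y, right_perp N Y -> hom_zero X Y.

(* Direct sums of copies of the simple module at k. *)
Definition add_simple (k : 'I_n) : subcat :=
  fun X => exists r, iso X (direct_sum (nseq r (simple P k))).

Definition forward_hom_orthogonal Ns :=
  forall i j, (i < j < size Ns)%N -> hom_zero (nth_mod Ns i) (nth_mod Ns j).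

Definition complete_fho Ns :=
  [/\ forall i, (i < size Ns)%N -> brick (nth_mod Ns i),
      forward_hom_orthogonal Ns,
      forall X, brick X -> gen_by (direct_sum Ns) X ->
        forall j, (j <= size Ns)%N ->
          ~ forward_hom_orthogonal (take j Ns ++ X :: drop j Ns)
    & forall X, gen_by (direct_sum Ns) X].

Definition torsion_class T :=
  [/\ T (zero_mod P),
      forall X Y, iso X Y -> T X -> T Y,
      forall X Y (f : jhom X Y), epic f -> T X -> T Y
    & forall X Y Z (f : jhom X Y) (g : jhom Y Z),
        short_exact f g -> T X -> T Z -> T Y].

Definition torsion_cover T T' :=
  [/\ torsion_class T, torsion_class T', subcat_proper T T'
    & forall T'', torsion_class T'' ->
        ~ (subcat_proper T T'' /\ subcat_proper T'' T')].

Definition maximal_green_sequence (m : nat) (T : nat -> subcat) :=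
  [/\ subcat_eq (T 0%N) (@is_zero K n P), forall X, T m X
    & forall i, (i < m)%N -> torsion_cover (T i) (T i.+1)].

(* 0 = X_ 0 -> X_ 1 -> ... -> X_ l = X, with subquotients F_ 0, ..., F_ l.-1. *)
Definition filtration X (l : nat) (X_ F_ : nat -> mod) :=
  [/\ is_zero (X_ 0%N), X_ l = X
    & forall j, (j < l)%N -> exists (f : jhom (X_ j) (X_ j.+1))
        (g : jhom (X_ j.+1) (F_ j)), short_exact f g].

Definition Filt Ns : subcat :=
  fun X => exists (l : nat) (X_ F_ : nat -> mod), filtration X l X_ F_ /\
     forall j, (j < l)%N ->
       exists2 i, (i < size Ns)%N & iso (F_ j) (nth_mod Ns i).

Definition mgs_of Ns (i : nat) : subcat := Filt (take i Ns).

End TorsionTheory.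

Arguments add_simple {K n} P k.

Section Stability.
Variables (R : realType) (K : fieldType) (n : nat) (P : qpot K n).

(* The argument in ]-pi, pi] of a nonzero complex number. *)
Definition Arg (z : R[i]) : R :=
  let t := acos (complex.Re z / Normc.normc z) in
  if 0 <= complex.Im z then t else - t.

Definition pairing (theta : 'cV[R]_n) (d : 'cV[int]_n) : R :=
  \sum_i theta i 0 * (d i 0)%:~R.

(* K_0 is identified with Z^n through the basis of simple modules. *)
Record central_charge := CentralCharge {
  re_charge : 'cV[R]_n;
  im_charge : 'cV[R]_n;
  im_charge_gt0 : forall i, 0 < im_charge i 0 }.

Definition charge (Z : central_charge) (d : 'cV[int]_n) : R[i] :=
  (pairing (re_charge Z) d +i* pairing (im_charge Z) d)%C.

Implicit Types (Z : central_charge) (X L : jmod P).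

Definition phase Z X : R := Arg (charge Z (dim_vector X)) / pi.

Definition semistable Z X :=
  ~ is_zero X /\
  forall L (f : jhom L X), ~ is_zero L -> monic f -> phase Z L <= phase Z X.

Definition hn_filtration Z X (l : nat) (X_ F_ : nat -> jmod P) :=
  [/\ filtration X l X_ F_,
      forall j, (j < l)%N -> semistable Z (F_ j)
    & forall j, (j.+1 < l)%N -> phase Z (F_ j.+1) < phase Z (F_ j)].

Definition max_destabilizing_quotient Z X F :=
  exists (l : nat) (X_ F_ : nat -> jmod P), hn_filtration Z X l.+1 X_ F_ /\ F_ l = F.

Definition torsion_ge Z (r : R) : subcat P :=
  fun X => is_zero X \/
    exists2 F, max_destabilizing_quotient Z X F & r <= phase Z F.

Definition mgs_induced_by m (T : nat -> subcat P) Z :=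
  [/\ maximal_green_sequence m T,
      forall r : R, 0 <= r <= 1 ->
        exists2 i, (i <= m)%N & subcat_eq (torsion_ge Z r) (T i)
    & forall i, (i <= m)%N ->
        exists2 r : R, 0 <= r <= 1 & subcat_eq (T i) (torsion_ge Z r)].

End Stability.

Section Functors.
Variables (K : fieldType) (n : nat) (P P' : qpot K n).

Record additive_functor := AdditiveFunctor {
  fobj :> jmod P -> jmod P';
  fmap : forall M N, jhom M N -> jhom (fobj M) (fobj N);
  fmap_id : forall M, fmap (jid M) = jid (fobj M);
  fmap_comp : forall M N L (g : jhom N L) (f : jhom M N),
    fmap (jcomp g f) = jcomp (fmap g) (fmap f);
  fmap_add : forall M N (f g : jhom M N), fmap (f + g) = fmap f + fmap g }.

Definition right_exact (F : additive_functor) :=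
  forall M N L (f : jhom M N) (g : jhom N L), exact_at f g -> epic g ->
    exact_at (fmap F f) (fmap F g) /\ epic (fmap F g).

Definition left_exact (F : additive_functor) :=
  forall M N L (f : jhom M N) (g : jhom N L), monic f -> exact_at f g ->
    monic (fmap F f) /\ exact_at (fmap F f) (fmap F g).

Definition preserves_short_exact_on (T : subcat P) (F : additive_functor) :=
  forall M N L (f : jhom M N) (g : jhom N L), T M -> T N -> T L ->
    short_exact f g -> short_exact (fmap F f) (fmap F g).

End Functors.

Definition reflection_matrix (T : pzRingType) (n : nat) (Q : quiver n) (k : 'I_n) :
    'M[T]_n :=
  \matrix_(i, j)
    if i == k then
      if j == k then -1
      else #|[pred a : arrow Q | (src a == k) && (tgt a == j)]|%:R
    else (i == j)%:R.

Arguments reflection_matrix T {n} Q k.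

Section Reflection.
Variables (K : fieldType) (n : nat).

Definition adjoint (P P' : qpot K n) (F : additive_functor P P')
    (G : additive_functor P' P) :=
  exists Phi : forall X Y, jhom (F X) Y -> jhom X (G Y),
    (forall X Y, bijective (@Phi X Y)) /\
    forall X X' Y Y' (f : jhom X' X) (h : jhom Y Y') (u : jhom (F X) Y),
      Phi X' Y' (jcomp h (jcomp u (fmap F f))) =
      jcomp (fmap G h) (jcomp (Phi X Y u) f).

(* G F is naturally isomorphic to the identity on the full subcategory T. *)
Definition retracts_on (P P' : qpot K n) (T : subcat P)
    (F : additive_functor P P') (G : additive_functor P' P) :=
  exists eta : forall X, jhom X (G (F X)),
    (forall X, T X -> is_iso (eta X)) /\
    forall X X' (f : jhom X X'), T X -> T X' ->
      jcomp (eta X') f = jcomp (fmap G (fmap F f)) (eta X).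

(* No construction of the generalized reflection functors is fixed: any pair with
   these properties is allowed. *)
Record reflection_functors (P P' : qpot K n) (k : 'I_n)
    (Fp : additive_functor P P') (Fm : additive_functor P' P) : Prop :=
  ReflectionFunctors {
    refl_right_exact : right_exact Fp;
    refl_left_exact : left_exact Fm;
    refl_adjoint : adjoint Fp Fm;
    refl_simple_p : forall X, add_simple P k X -> is_zero (Fp X);
    refl_simple_m : forall Y, add_simple P' k Y -> is_zero (Fm Y);
    refl_perp_p : forall X, right_perp (simple P k) X ->
      left_perp (simple P' k) (Fp X);
    refl_perp_m : forall Y, left_perp (simple P' k) Y ->
      right_perp (simple P k) (Fm Y);
    refl_mp : retracts_on (right_perp (simple P k)) Fp Fm;
    refl_pm : retracts_on (left_perp (simple P' k)) Fm Fp;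
    refl_ses_p : preserves_short_exact_on (right_perp (simple P k)) Fp;
    refl_ses_m : preserves_short_exact_on (left_perp (simple P' k)) Fm;
    refl_dim : forall V, right_perp (simple P k) V ->
      dim_vector (Fp V) = reflection_matrix int P k *m dim_vector V }.

End Reflection.

(* Main.v *)
Require Import Defs.
From HB Require Import structures.
From mathcomp Require Import all_boot all_order all_algebra.
From mathcomp Require Import boolp reals trigo complex ring.
Import Order.TTheory GRing.Theory Num.Theory.
(* Repeated last, so that [monic] qualifies homomorphisms and not polynomials. *)
Import Defs.
Local Open Scope ring_scope.

(** Why the theorem holds. Two facts are combined: reflection turns the sequence
    [N1 :: Ns] into a complete forward hom-orthogonal sequence of the mutated
    algebra, and a central charge whose phases decrease along such a sequence
    induces the associated maximal green sequence.

    The second fact is about any complete forward hom-orthogonal sequence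
    [M_0, ..., M_(m-1)]. Let [torf i] be the class of modules receiving no
    nonzero map from [M_0, ..., M_(i-1)], and [tors i] its left orthogonal: these
    form a torsion pair, and [M_i] lies in the slice [tors i.+1] cap [torf i].
    Every nonzero [X] in that slice maps onto [M_i] ([tors_torf_epic]): otherwise
    a brick quotient of [X] could be inserted before [M_i]. Splitting off copies
    of [M_i], one finds that the slice is exactly [Filt [:: M_i]]
    ([tors_torf_Filt]). Cutting a module by its torsion parts then gives
    [tors i = Filt (M_0, ..., M_(i-1))], and a torsion class strictly above
    [tors i] and inside [tors i.+1] contains [M_i], hence is [tors i.+1]; this is
    the maximal green sequence ([mgs_of_cfho]).

    With a central charge of positive imaginary part, the phase is a decreasing
    function of the slope, the quotient of the real part by the imaginary part.
    If slopes increase along the sequence, a nonzero module of [torf i] has slope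
    at least that of [M_i], being filtered by [M_i, ..., M_(m-1)]. Hence every
    nonzero module of the slice is semistable with the slope of [M_i]
    ([tors_torf_semistable]), the torsion parts of a module form its
    Harder-Narasimhan filtration ([tors_hn]), and a semistable module of phase
    larger than those of [M_i, ..., M_(m-1)] is in [tors i] by the seesaw property
    ([semistable_tors]). So the class of phase at least [r] is [tors i], where [i]
    counts the [M_j] of phase at least [r] ([torsion_geE], [mgs_of_induced]).

    For the first fact ([reflected_cfho]), the two functors are inverse
    equivalences between the right orthogonal of [S_k], which contains [Ns], and
    the left orthogonal of [S'_k]; bricks, vanishing of homomorphisms and
    insertions are carried through them. A nonzero module orthogonal to the whole
    new sequence would have a minimal submodule which is either [S'_k] or the
    reflection of a module orthogonal to [N1 :: Ns] ([reflected_generates]).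

    Finally the slopes of the two sequences agree. Since the reflection matrix [B]
    squares to the identity, pairing [B^T theta] with [B d] is pairing [theta]
    with [d]; and [B] changes the sign of the [k]-th basis vector, so that the
    signs cancel in the slope of [S'_k], which therefore comes last as [N1] does
    in the hypothesis. *)

(** * Submodules, quotients and short exact sequences *)

Section Homomorphisms.
Set Implicit Arguments.
Unset Strict Implicit.
Variables (K : fieldType) (n : nat) (P : qpot K n).
Implicit Types (L M N X Y Z Q : jmod P).

Lemma jhom_act M N (f : jhom M N) x v : f (jact M x v) = jact N x (f v).
Proof. by have /asboolP/(_ x)/lfunP/(_ v) := jhomP f; rewrite !lfunE. Qed.

Lemma jhom_ext M N (f g : jhom M N) : f =1 g -> f = g.
Proof. by move=> fg; apply/val_inj/lfunP. Qed.

Lemma jhom0E M N v : (0 : jhom M N) v = 0.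
Proof. exact: zero_lfunE. Qed.

Lemma jhomBE M N (f g : jhom M N) v : (f - g) v = f v - g v.
Proof.
have -> : (f - g : jhom M N) v = (val f - val g) v by [].
by rewrite add_lfunE opp_lfunE.
Qed.

Lemma jidE M v : jid M v = v.
Proof. exact: id_lfunE. Qed.

Lemma jcompE M N L (g : jhom N L) (f : jhom M N) v : jcomp g f v = g (f v).
Proof. exact: comp_lfunE. Qed.

Lemma jcompA M N L X (h : jhom L X) (g : jhom N L) (f : jhom M N) :
  jcomp h (jcomp g f) = jcomp (jcomp h g) f.
Proof. by apply: jhom_ext => v; rewrite !jcompE. Qed.

Lemma jcomp1l M N (f : jhom M N) : jcomp (jid N) f = f.
Proof. by apply: jhom_ext => v; rewrite jcompE jidE. Qed.

Lemma jcomp1r M N (f : jhom M N) : jcomp f (jid M) = f.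
Proof. by apply: jhom_ext => v; rewrite jcompE jidE. Qed.

Lemma jcomp0l M N L (f : jhom M N) : jcomp (0 : jhom N L) f = 0.
Proof. by apply: jhom_ext => v; rewrite jcompE !jhom0E. Qed.

Lemma jcomp0r M N L (g : jhom N L) : jcomp g (0 : jhom M N) = 0.
Proof. by apply: jhom_ext => v; rewrite jcompE !jhom0E linear0. Qed.

(** Homomorphisms are handled through their values: the bundled commutation proof
    would otherwise obstruct rewriting. *)
Lemma jhom_intro M N (h : 'Hom(M, N)) :
  (forall x v, h (jact M x v) = jact N x (h v)) ->
  exists f : jhom M N, forall v, f v = h v.
Proof.
move=> hP; have h_hom : h \in @is_jhom K n P M N.
  by apply/asboolP => x; apply/lfunP => v; rewrite !lfunE /=.
by exists (JHom h_hom).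
Qed.

Lemma monicP M N (f : jhom M N) : monic f <-> injective f.
Proof. by split=> [/lker0P | /lker0P]. Qed.

Lemma monic_eq0 M N (f : jhom M N) : (forall v, f v = 0 -> v = 0) -> monic f.
Proof.
move=> f0; apply/monicP => u v fuv; apply/eqP; rewrite -subr_eq0.
by apply/eqP/f0; rewrite linearB /= fuv subrr.
Qed.

Lemma epicP M N (f : jhom M N) : epic f <-> forall w, exists v, w = f v.
Proof.
split=> [/eqP fE w | fP].
  have: w \in limg f by rewrite fE memvf.
  by move/memv_imgP => [v _ ->]; exists v.
apply/eqP/vspaceP => w; rewrite memvf.
by have [v ->] := fP w; rewrite memv_img // memvf.
Qed.

Lemma exact_atP M N L (f : jhom M N) (g : jhom N L) :
  exact_at f g <-> forall w, g w = 0 <-> exists v, w = f v.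
Proof.
split=> [/eqP/vspaceP fg w | fg].
  have := fg w; rewrite memv_ker => gw; split.
    by move/eqP; rewrite -gw => /memv_imgP[v _ ->]; exists v.
  by move=> [v wE]; apply/eqP; rewrite -gw wE memv_img // memvf.
apply/eqP/vspaceP => w; rewrite memv_ker; apply/idP/eqP.
  by move=> /memv_imgP[v _ wE]; apply/fg; exists v.
by move/fg => [v ->]; rewrite memv_img // memvf.
Qed.

Lemma exact_comp0 M N L (f : jhom M N) (g : jhom N L) :
  exact_at f g -> jcomp g f = 0.
Proof.
move=> /exact_atP fg; apply: jhom_ext => v; rewrite jcompE jhom0E.
by apply/fg; exists v.
Qed.

Definition stable M (U : {vspace M}) := forall x v, v \in U -> jact M x v \in U.

Lemma lker_stable M N (f : jhom M N) : stable (lker f).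
Proof. by move=> x v; rewrite !memv_ker jhom_act => /eqP->; rewrite linear0. Qed.

Lemma limg_stable M N (f : jhom M N) : stable (limg f).
Proof.
by move=> x w /memv_imgP[v _ ->]; rewrite -jhom_act memv_img // memvf.
Qed.

Section Subquotient.
Variables (M : jmod P) (U : {vspace M}) (stableU : stable U).

Definition sub_fun x (u : subvs_of U) : subvs_of U := vsproj U (jact M x (vsval u)).

Lemma sub_fun_val x u : vsval (sub_fun x u) = jact M x (vsval u).
Proof. by rewrite vsprojK //; apply/stableU/subvsP. Qed.

Lemma sub_fun_linear x : linear (sub_fun x).
Proof. by move=> c u v; rewrite /sub_fun !linearP. Qed.
HB.instance Definition _ x := GRing.isLinear.Build K (subvs_of U) (subvs_of U)
  *:%R (sub_fun x) (sub_fun_linear x).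

Definition sub_act (x : jacobian P) : 'End(subvs_of U) := linfun (sub_fun x).

Lemma sub_actE x u : vsval (sub_act x u) = jact M x (vsval u).
Proof. by rewrite lfunE /= sub_fun_val. Qed.

Lemma sub_act_linear : linear sub_act.
Proof.
move=> c x y; apply/lfunP => u; rewrite add_lfunE scale_lfunE.
by apply: subvs_inj; rewrite linearP /= !sub_actE linearP add_lfunE scale_lfunE.
Qed.
HB.instance Definition _ := GRing.isLinear.Build K (jacobian P) 'End(subvs_of U)
  *:%R sub_act sub_act_linear.

Lemma sub_act1 : sub_act 1 = \1%VF.
Proof.
by apply/lfunP => u; apply: subvs_inj; rewrite sub_actE jact1 !id_lfunE.
Qed.

Lemma sub_actM x y : sub_act (x * y) = (sub_act x \o sub_act y)%VF.
Proof.
by apply/lfunP => u; apply: subvs_inj; rewrite comp_lfunE !sub_actE jactM comp_lfunE.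
Qed.

Lemma submodule : exists L (i : jhom L M), monic i /\ limg i = U.
Proof.
pose L := @JMod K n P (subvs_of U) sub_act sub_act1 sub_actM.
have [|i iE] := @jhom_intro L M (linfun vsval).
  by move=> x v; rewrite !(@lfunE _ _ _ vsval); apply: sub_actE.
have {}iE v : i v = vsval v by rewrite iE lfunE.
exists L, i; split; first by apply/monicP => u v; rewrite !iE => /subvs_inj.
apply/vspaceP => w; apply/memv_imgP/idP => [[u _ ->]|wU]; first by rewrite iE subvsP.
by exists (vsproj U w); rewrite ?memvf // iE vsprojK.
Qed.

(** Quotients are carried by the image of the projection along [U] onto a
    complement: the action is followed by this projection, which is compatible
    with products as [U], its kernel, is stable. *)
Definition quo_proj : 'End(M) := (\1 - projv U)%VF.

Lemma quo_projE v : quo_proj v = v - projv U v.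
Proof. by rewrite add_lfunE opp_lfunE id_lfunE. Qed.

Lemma quo_proj_eq0 v : (quo_proj v == 0) = (v \in U).
Proof.
rewrite quo_projE subr_eq0; apply/eqP/idP => [->|/projv_id-> //].
exact: memv_proj.
Qed.

Lemma quo_proj_act x v : quo_proj (jact M x (quo_proj v)) = quo_proj (jact M x v).
Proof.
apply/eqP; rewrite -subr_eq0 -linearB quo_proj_eq0 -linearB; apply: stableU.
by rewrite quo_projE addrAC subrr sub0r memvN memv_proj.
Qed.

Definition quo_class v : subvs_of (limg quo_proj) :=
  vsproj (limg quo_proj) (quo_proj v).

Lemma quo_class_val v : vsval (quo_class v) = quo_proj v.
Proof. by rewrite vsprojK // memv_img // memvf. Qed.

Lemma quo_class_linear : linear quo_class.
Proof. by move=> c u v; rewrite /quo_class !linearP. Qed.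
HB.instance Definition _ := GRing.isLinear.Build K M (subvs_of (limg quo_proj))
  *:%R quo_class quo_class_linear.

Definition quo_fun x (u : subvs_of (limg quo_proj)) := quo_class (jact M x (vsval u)).

Lemma quo_fun_linear x : linear (quo_fun x).
Proof. by move=> c u v; rewrite /quo_fun !linearP. Qed.
HB.instance Definition _ x := GRing.isLinear.Build K (subvs_of (limg quo_proj))
  (subvs_of (limg quo_proj)) *:%R (quo_fun x) (quo_fun_linear x).

Definition quo_act (x : jacobian P) : 'End(subvs_of (limg quo_proj)) :=
  linfun (quo_fun x).

Lemma quo_funE x v : quo_fun x (quo_class v) = quo_class (jact M x v).
Proof. by apply: subvs_inj; rewrite !quo_class_val quo_proj_act. Qed.

Lemma quo_class_surj u : exists v, u = quo_class v.
Proof.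
have /memv_imgP[v _ uE] := subvsP u; exists v.
by apply: subvs_inj; rewrite quo_class_val.
Qed.

Lemma quo_actE x v : quo_act x (quo_class v) = quo_class (jact M x v).
Proof. by rewrite lfunE /= quo_funE. Qed.

Lemma quo_act_linear : linear quo_act.
Proof.
move=> c x y; apply/lfunP => u; have [v ->] := quo_class_surj u.
by rewrite add_lfunE scale_lfunE !quo_actE linearP add_lfunE scale_lfunE linearP.
Qed.
HB.instance Definition _ := GRing.isLinear.Build K (jacobian P)
  'End(subvs_of (limg quo_proj)) *:%R quo_act quo_act_linear.

Lemma quo_act1 : quo_act 1 = \1%VF.
Proof.
apply/lfunP => u; have [v ->] := quo_class_surj u.
by rewrite quo_actE jact1 !id_lfunE.
Qed.

Lemma quo_actM x y : quo_act (x * y) = (quo_act x \o quo_act y)%VF.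
Proof.
apply/lfunP => u; have [v ->] := quo_class_surj u.
by rewrite comp_lfunE !quo_actE jactM comp_lfunE.
Qed.

Lemma quotient_module : exists Q (q : jhom M Q), epic q /\ lker q = U.
Proof.
pose Q := @JMod K n P (subvs_of (limg quo_proj)) quo_act quo_act1 quo_actM.
have [|q qE] := @jhom_intro M Q (linfun quo_class).
  by move=> x v; rewrite !(@lfunE _ _ _ quo_class); apply/esym/quo_actE.
have {}qE v : q v = quo_class v by rewrite qE lfunE.
exists Q, q; split.
  by apply/epicP => u; have [v ->] := quo_class_surj u; exists v; rewrite qE.
apply/vspaceP => v; rewrite memv_ker qE -quo_proj_eq0 -quo_class_val.
by rewrite -(inj_eq subvs_inj).
Qed.

End Subquotient.

Lemma factor_monic L M X (i : jhom L M) (f : jhom X M) :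
  monic i -> (forall x, exists u, f x = i u) -> exists g : jhom X L, jcomp i g = f.
Proof.
move=> mi fi; have fK x : i ((i : 'Hom(L, M))^-1%VF (f x)) = f x.
  by have [u ->] := fi x; rewrite lker0_lfunK.
have [|g gE] := @jhom_intro X L (i^-1 \o f)%VF.
  move=> x v; apply/(proj1 (monicP i) mi).
  by rewrite jhom_act !comp_lfunE !fK jhom_act.
by exists g; apply: jhom_ext => v; rewrite jcompE gE comp_lfunE fK.
Qed.

Lemma factor_epic M Q X (q : jhom M Q) (f : jhom M X) :
  epic q -> (forall v, q v = 0 -> f v = 0) -> exists g : jhom Q X, jcomp g q = f.
Proof.
move=> eq qf; have qK w : q ((q : 'Hom(M, Q))^-1%VF w) = w.
  by rewrite limg_lfunVK // (eqP eq) memvf.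
have fE u v : q u = q v -> f u = f v.
  move=> quv; apply/eqP; rewrite -subr_eq0 -linearB; apply/eqP/qf.
  by rewrite linearB /= quv subrr.
have [|g gE] := @jhom_intro Q X (f \o q^-1)%VF.
  move=> x w; rewrite !comp_lfunE -jhom_act; apply: fE.
  by rewrite qK jhom_act qK.
by exists g; apply: jhom_ext => v; rewrite jcompE gE comp_lfunE; apply/fE; rewrite qK.
Qed.

Lemma kernel M N (f : jhom M N) : exists L (i : jhom L M), monic i /\ exact_at i f.
Proof.
have [L [i [mi iE]]] := submodule (@lker_stable _ _ f).
by exists L, i; rewrite /exact_at iE.
Qed.

Lemma cokernel M N (f : jhom M N) : exists Q (q : jhom N Q), epic q /\ exact_at f q.
Proof.
have [Q [q [eq qE]]] := quotient_module (@limg_stable _ _ f).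
by exists Q, q; rewrite /exact_at qE.
Qed.

Lemma image M N (f : jhom M N) :
  exists I (e : jhom M I) (i : jhom I N), [/\ epic e, monic i & f = jcomp i e].
Proof.
have [I [i [mi iE]]] := submodule (@limg_stable _ _ f).
have [v|e eE] := @factor_monic I N M i f mi.
  have: f v \in limg i by rewrite iE memv_img // memvf.
  by move/memv_imgP => [u _ ->]; exists u.
exists I, e, i; split=> //; apply/epicP => w.
have: i w \in limg f by rewrite -iE memv_img // memvf.
move/memv_imgP => [v _]; rewrite -eE jcompE => /(proj1 (monicP i) mi) ->.
by exists v.
Qed.

Lemma is_iso_monic_epic M N (f : jhom M N) : is_iso f <-> monic f /\ epic f.
Proof.
split=> [[g [gf fg]]|[mf ef]].
  split; first by apply: monic_eq0 => v fv; rewrite -(jidE v) -gf jcompE fv linear0.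
  by apply/epicP => w; exists (g w); rewrite -jcompE fg jidE.
have [w|g fg] := @factor_monic M N N f (jid N) mf.
  by have [v wE] := proj1 (epicP f) ef w; exists v; rewrite jidE.
exists g; split=> //; apply: jhom_ext => v; apply/(proj1 (monicP f) mf).
by rewrite jcompE -jcompE fg !jidE.
Qed.

Lemma iso_refl M : iso M M.
Proof. by exists (jid M), (jid M); rewrite jcomp1l. Qed.

Lemma iso_sym M N : iso M N -> iso N M.
Proof. by move=> [f [g [gf fg]]]; exists g, f. Qed.

Lemma is_iso_comp M N L (g : jhom N L) (f : jhom M N) :
  is_iso g -> is_iso f -> is_iso (jcomp g f).
Proof.
move=> [g' [g'g gg']] [f' [f'f ff']]; exists (jcomp f' g').
rewrite -!jcompA (jcompA g') g'g jcomp1l f'f; split=> //.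
by rewrite (jcompA f) ff' jcomp1l.
Qed.

Lemma hom_zero_iso M M' N N' : iso M M' -> iso N N' -> hom_zero M N -> hom_zero M' N'.
Proof.
move=> [f [f' [f'f ff']]] [g [g' [g'g gg']]] MN h.
have := MN (jcomp g' (jcomp h f)) => /(congr1 (fun u => jcomp g (jcomp u f'))).
by rewrite jcomp0l jcomp0r -!jcompA ff' jcomp1r jcompA gg' jcomp1l.
Qed.

Lemma monic_comp M N L (g : jhom N L) (f : jhom M N) :
  monic g -> monic f -> monic (jcomp g f).
Proof.
move=> /monicP mg /monicP mf; apply/monicP => u v; rewrite !jcompE.
by move=> /mg/mf.
Qed.

Lemma epic_comp M N L (g : jhom N L) (f : jhom M N) :
  epic g -> epic f -> epic (jcomp g f).
Proof.
move=> /epicP eg /epicP ef; apply/epicP => w.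
by have [v ->] := eg w; have [u ->] := ef v; exists u; rewrite jcompE.
Qed.

Lemma epic_comp_eq0 M N L (g : jhom N L) (f : jhom M N) :
  epic f -> jcomp g f = 0 -> g = 0.
Proof.
move=> /epicP ef gf; apply: jhom_ext => w; have [v ->] := ef w.
by rewrite -jcompE gf !jhom0E.
Qed.

Lemma monic_comp_eq0 M N L (g : jhom N L) (f : jhom M N) :
  monic g -> jcomp g f = 0 -> f = 0.
Proof.
move=> /monicP mg gf; apply: jhom_ext => v; apply: mg.
by rewrite -jcompE gf !jhom0E linear0.
Qed.

(** * Dimensions and zero modules *)

Definition mdim M := \dim {:M}.

Lemma is_zeroP M : is_zero M <-> forall v : M, v = 0.
Proof.
rewrite /is_zero; split=> [/eqP M0 v|M0].
  by apply/eqP; rewrite -memv0; move: M0; rewrite dimv_eq0 => /eqP<-; rewrite memvf.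
apply/eqP; rewrite dimv_eq0 -subv0; apply/subvP => v _.
by rewrite (M0 v) mem0v.
Qed.

Lemma is_zero_mdim M : ~ is_zero M <-> (0 < mdim M)%N.
Proof. by rewrite lt0n; split=> /eqP. Qed.

Lemma is_zero_zero_mod : is_zero (zero_mod P).
Proof. by apply/is_zeroP => v; apply/rowP; case. Qed.

Lemma hom_zero_from0 M N : is_zero M -> hom_zero M N.
Proof.
by move=> /is_zeroP M0 f; apply: jhom_ext => v; rewrite (M0 v) !linear0.
Qed.

Lemma hom_zero_to0 M N : is_zero N -> hom_zero M N.
Proof. by move=> /is_zeroP N0 f; apply: jhom_ext => v; rewrite !(N0 (_ v)). Qed.

Lemma jid0_is_zero M : jid M = 0 <-> is_zero M.
Proof.
split=> [M0|M0]; last exact: hom_zero_to0.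
by apply/is_zeroP => v; rewrite -(jidE v) M0 jhom0E.
Qed.

Lemma epic_is_zero M N (f : jhom M N) : epic f -> is_zero M -> is_zero N.
Proof.
move=> /epicP ef /is_zeroP M0; apply/is_zeroP => w.
by have [v ->] := ef w; rewrite (M0 v) linear0.
Qed.

Lemma iso_is_zero M N : iso M N -> is_zero M -> is_zero N.
Proof. by move=> [f /is_iso_monic_epic[_ /epic_is_zero]]. Qed.

Lemma is_zero_iso M N : is_zero M -> is_zero N -> iso M N.
Proof.
move=> M0 N0; exists 0, 0.
by split; apply/esym; rewrite jcomp0l; apply/jid0_is_zero.
Qed.

Lemma monic_is_iso M N (f : jhom M N) : monic f -> (mdim N <= mdim M)%N -> is_iso f.
Proof.
move=> mf dMN; apply/is_iso_monic_epic; split=> //.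
rewrite /epic eqEdim subvf /=; apply: leq_trans dMN _.
by rewrite /mdim -(limg_ker_dim f) (eqP mf) capv0 dimv0.
Qed.

Lemma short_exact_mdim L M N (f : jhom L M) (g : jhom M N) :
  short_exact f g -> mdim M = (mdim L + mdim N)%N.
Proof.
move=> [mf /eqP fg eg]; rewrite /mdim -(limg_ker_dim g fullv) capfv (eqP eg) -fg.
by rewrite -(limg_ker_dim f fullv) (eqP mf) capv0 dimv0.
Qed.

Lemma short_exact_epic M N (g : jhom M N) :
  epic g -> exists L (f : jhom L M), short_exact f g.
Proof. by have [L [f [mf fg]]] := kernel g; exists L, f. Qed.

Lemma short_exact_monic M N (f : jhom M N) :
  monic f -> exists Q (g : jhom N Q), short_exact f g.
Proof. by have [Q [g [eg fg]]] := cokernel f; exists Q, g. Qed.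

Lemma short_exact_0l Z M N : is_zero Z -> iso M N ->
  exists (f : jhom Z M) (g : jhom M N), short_exact f g.
Proof.
move=> Z0 [g /is_iso_monic_epic[mg eg]]; exists 0, g; split=> //.
  by apply: monic_eq0 => v _; have /is_zeroP := Z0; apply.
apply/exact_atP => w; split=> [gw|[v ->]]; last by rewrite jhom0E linear0.
by exists 0; rewrite linear0; apply/(proj1 (monicP g) mg); rewrite gw linear0.
Qed.

Lemma short_exact_iso_mid L M N M' (f : jhom L M) (g : jhom M N) (h : jhom M M') :
  short_exact f g -> is_iso h ->
  exists (f' : jhom L M') (g' : jhom M' N), short_exact f' g'.
Proof.
move=> [mf /exact_atP fg eg] hi; have [h' [h'h hh']] := hi.
have h'i : is_iso h' by exists h.
exists (jcomp h f), (jcomp g h'); split.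
- by apply: monic_comp => //; have /is_iso_monic_epic[] := hi.
- apply/exact_atP => w; split=> [|[v ->]].
    rewrite jcompE => /fg[v h'w]; exists v.
    by rewrite jcompE -h'w -jcompE hh' jidE.
  by rewrite !jcompE -(jcompE h' h) h'h jidE; apply/fg; exists v.
- by apply: epic_comp => //; have /is_iso_monic_epic[] := h'i.
Qed.

Lemma short_exact_zerol L M N (f : jhom L M) (g : jhom M N) :
  short_exact f g -> is_zero L -> iso M N.
Proof.
move=> [mf /exact_atP fg eg] L0; exists g; apply/is_iso_monic_epic; split=> //.
apply: monic_eq0 => v /fg[u ->]; have /is_zeroP L0' := L0.
by rewrite (L0' u) linear0.
Qed.

Lemma short_exact_zeror L M N (f : jhom L M) (g : jhom M N) :
  short_exact f g -> is_zero N -> iso L M.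
Proof.
move=> [mf /exact_atP fg eg] N0; exists f; apply/is_iso_monic_epic; split=> //.
apply/epicP => w; have [|u ->] := proj1 (fg w); last by exists u.
by have /is_zeroP N0' := N0; rewrite (N0' (g w)).
Qed.

(** [Y] is the preimage of the submodule [A] of the quotient [C]. This serves both to
    enlarge torsion submodules and to concatenate filtrations. *)
Lemma short_exact_pullback L X C A Q (i : jhom L X) (q : jhom X C)
    (j : jhom A C) (p : jhom C Q) :
  short_exact i q -> short_exact j p ->
  exists Y (l : jhom L Y) (r : jhom Y A) (y : jhom Y X),
    short_exact l r /\ short_exact y (jcomp p q).
Proof.
move=> [mi /exact_atP iq eq] [mj /exact_atP jp ep].
have [Y [y [my yE]]] := kernel (jcomp p q); have /exact_atP yP := yE.
have [u|r jr] := @factor_monic A C Y j (jcomp q y) mj.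
  have [|a ->] := proj1 (jp (jcomp q y u)); last by exists a.
  by rewrite jcompE -jcompE; apply/yP; exists u.
have [v|l yl] := @factor_monic Y X L y i my.
  have [|u ->] := proj1 (yP (i v)); last by exists u.
  by rewrite jcompE (proj2 (iq _)) ?linear0 //; exists v.
exists Y, l, r, y; split; last by split=> //; exact: epic_comp.
split.
- apply: monic_eq0 => v lv; apply/(proj1 (monicP i) mi).
  by rewrite -yl jcompE lv !linear0.
- apply/exact_atP => u; split=> [ru|[v ->]].
    have [|v yv] := proj1 (iq (y u)); first by rewrite -jcompE -jr jcompE ru linear0.
    by exists v; apply/(proj1 (monicP y) my); rewrite yv -yl jcompE.
  apply/(proj1 (monicP j) mj); rewrite -jcompE jr linear0 jcompE -(jcompE y l) yl.
  by apply/iq; exists v.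
- apply/epicP => a; have [x xE] := proj1 (epicP q) eq (j a).
  have [|u xu] := proj1 (yP x); first by rewrite jcompE -xE; apply/jp; exists a.
  by exists u; apply/(proj1 (monicP j) mj); rewrite xE xu -jcompE -jr jcompE.
Qed.

(** [C] is the quotient of [X] by the submodule [A] of [L]: the third isomorphism
    theorem. *)
Lemma short_exact_pushout L X M A Q (i : jhom L X) (q : jhom X M)
    (j : jhom A L) (p : jhom L Q) :
  short_exact i q -> short_exact j p ->
  exists C (c : jhom X C) (u : jhom Q C) (w : jhom C M),
    short_exact (jcomp i j) c /\ short_exact u w.
Proof.
move=> [mi /exact_atP iq eq] [mj /exact_atP jp ep].
have [C [c cE]] := short_exact_monic (monic_comp mi mj).
have [_ /exact_atP ijc ec] := cE.
have [x px|u up] := @factor_epic L Q C p (jcomp c i) ep.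
  by have [a ->] := proj1 (jp x) px; rewrite jcompE -(jcompE i j); apply/ijc; exists a.
have [x cx|w wc] := @factor_epic X C M c q ec.
  by have [a ->] := proj1 (ijc x) cx; rewrite jcompE; apply/iq; exists (j a).
exists C, c, u, w; split=> //; split.
- apply: monic_eq0 => y; have [x ->] := proj1 (epicP p) ep y.
  rewrite -jcompE up jcompE => /ijc[a]; rewrite jcompE => /(proj1 (monicP i) mi) ->.
  by apply/jp; exists a.
- apply/exact_atP => y; have [x ->] := proj1 (epicP c) ec y; split=> [|[z ->]].
    rewrite -jcompE wc => /iq[z ->]; exists (p z).
    by rewrite -(jcompE u) up jcompE.
  have [l ->] := proj1 (epicP p) ep z.
  by rewrite -(jcompE u) up jcompE -(jcompE w) wc; apply/iq; exists l.
- apply/epicP => y; have [x ->] := proj1 (epicP q) eq y.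
  by exists (c x); rewrite -jcompE wc.
Qed.

Lemma short_exact_factorl L X C Y (i : jhom L X) (q : jhom X C) (f : jhom Y X) :
  short_exact i q -> jcomp q f = 0 -> exists g : jhom Y L, jcomp i g = f.
Proof.
move=> [mi /exact_atP iq _] qf; apply: factor_monic => // v.
by apply/iq; rewrite -jcompE qf jhom0E.
Qed.

Lemma short_exact_factorr L X C Y (i : jhom L X) (q : jhom X C) (f : jhom X Y) :
  short_exact i q -> jcomp f i = 0 -> exists g : jhom C Y, jcomp g q = f.
Proof.
move=> [_ /exact_atP iq eq] fi; apply: factor_epic => // v /iq[u ->].
by rewrite -jcompE fi jhom0E.
Qed.

End Homomorphisms.

(** * Torsion classes, bricks and filtrations *)

Section TorsionBricks.
Set Implicit Arguments.
Unset Strict Implicit.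
Variables (K : fieldType) (n : nat) (P : qpot K n).
Implicit Types (L M N X Y Z Q : jmod P) (T : subcat P) (Ns : seq (jmod P)).

Lemma torsion_class_zero T X : torsion_class T -> is_zero X -> T X.
Proof.
move=> [T0 Tiso _ _] X0; apply: Tiso T0.
by apply: is_zero_iso => //; apply: is_zero_zero_mod.
Qed.

(** As long as the quotient receives a nonzero map from a module of [T], the preimage
    of the image of that map is a larger submodule in [T]; the quotient shrinks at
    each step. *)
Lemma torsion_part T X : torsion_class T ->
  exists tX Q (i : jhom tX X) (q : jhom X Q),
    [/\ short_exact i q, T tX & forall Z, T Z -> hom_zero Z Q].
Proof.
move=> Ttors; have [T0 Tiso Tepi Text] := Ttors.
have [d] := ubnP (mdim X); elim: d X => // d IH X dX.
have [Xfree|/existsNP[Z /not_implyP[TZ /existsNP[f f0]]]] :=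
  pselect (forall Z, T Z -> hom_zero Z X).
  have [i [q iq]] := short_exact_0l (is_zero_zero_mod P) (iso_refl X).
  by exists (zero_mod P), X, i, q.
have [I [e [i [ee mi fE]]]] := image f.
have [C [q iq]] := short_exact_monic mi.
have I0 : ~ is_zero I by move=> I0; apply: f0; rewrite fE (hom_zero_to0 I0 e) jcomp0r.
have [|tC [Q [j [p [jp TtC Qfree]]]]] := IH C.
  move: dX; rewrite (short_exact_mdim iq) ltnS; apply: leq_trans.
  by rewrite -[ltnLHS]add0n ltn_add2r; apply/is_zero_mdim.
have [tX [l [r [y [lr ypq]]]]] := short_exact_pullback iq jp.
by exists tX, Q, y, (jcomp p q); split=> //; apply: Text lr (Tepi _ _ _ ee TZ) TtC.
Qed.

(** A nonzero module that is not a brick has a nonzero endomorphism that is not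
    bijective; its image is a smaller module which is again both a submodule and a
    quotient, so that one may recurse. *)
Lemma brick_subquotient X : ~ is_zero X ->
  exists B (q : jhom X B) (i : jhom B X), [/\ brick B, epic q & monic i].
Proof.
have [d] := ubnP (mdim X); elim: d X => // d IH X dX X0.
have [Xb|Xnb] := pselect (brick X).
  exists X, (jid X), (jid X).
  have /is_iso_monic_epic[mX eX] : is_iso (jid X) by exists (jid X); rewrite jcomp1l.
  by split.
have /existsNP[f /not_implyP[f0 fni]] : ~ forall f : jhom X X, f <> 0 -> is_iso f.
  by move=> Xb; apply: Xnb; split=> // /jid0_is_zero.
have [I [e [i [ee mi fE]]]] := image f.
have I0 : ~ is_zero I by move=> I0; apply: f0; rewrite fE (hom_zero_to0 I0 e) jcomp0r.
have [|//|B [q [j [Bb eq mj]]]] := IH I.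
  move: dX; rewrite ltnS; apply: leq_trans; rewrite ltnNge; apply/negP => dI.
  apply: fni; rewrite fE; apply: is_iso_comp; first exact: monic_is_iso.
  have [L [k ke]] := short_exact_epic ee; apply/is_iso_monic_epic; split=> //.
  have L0 : is_zero L.
    move: dI; rewrite (short_exact_mdim ke) -[leqRHS]add0n leq_add2r leqn0.
    by move/eqP.
  apply: monic_eq0 => v; have [_ /exact_atP ke0 _] := ke.
  by move=> /ke0[u ->]; move/is_zeroP: L0 => L0; rewrite (L0 u) linear0.
exists B, (jcomp q e), (jcomp i j).
by split=> //; [exact: epic_comp | exact: monic_comp].
Qed.

Lemma brick_nonzero X : brick X -> ~ is_zero X.
Proof. by move=> [X0 _] /jid0_is_zero. Qed.

Lemma filtration_snoc X Y Z (l : nat) (X_ F_ : nat -> jmod P)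
    (f : jhom X Y) (g : jhom Y Z) :
  filtration X l X_ F_ -> short_exact f g ->
  filtration Y l.+1 (fun t => if (t <= l)%N then X_ t else Y)
    (fun t => if (t < l)%N then F_ t else Z).
Proof.
move=> [X0 XE XF] fg; subst X; split; rewrite ?leq0n ?ltnn // => j jl.
have {jl} /predU1P[->|jl] /= : (j == l) || (j < l)%N by rewrite -leq_eqVlt.
  by rewrite leqnn ltnn; exists f, g.
by rewrite (ltnW jl) jl; apply: XF.
Qed.

Lemma Filt_zero Ns X : is_zero X -> Filt Ns X.
Proof. by move=> X0; exists 0%N, (fun=> X), (fun=> X). Qed.

Lemma Filt_snoc Ns X Y Z (f : jhom X Y) (g : jhom Y Z) :
  short_exact f g -> Filt Ns X ->
  (exists2 i, (i < size Ns)%N & iso Z (nth_mod Ns i)) -> Filt Ns Y.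
Proof.
move=> fg [l [X_ [F_ [XF FN]]]] ZN; exists l.+1.
do 2!eexists; split; first exact: filtration_snoc XF fg.
move=> j; rewrite ltnS leq_eqVlt => /predU1P[->|jl]; first by rewrite ltnn.
by rewrite jl; apply: FN.
Qed.

(** Together with [Filt_zero] and [Filt_snoc] this presents [Filt] as an inductive
    class, and the sequences of submodules need not be mentioned any more. *)
Lemma Filt_ind Ns T :
  (forall X, is_zero X -> T X) ->
  (forall X Y Z (f : jhom X Y) (g : jhom Y Z), short_exact f g -> T X ->
     (exists2 i, (i < size Ns)%N & iso Z (nth_mod Ns i)) -> T Y) ->
  forall X, Filt Ns X -> T X.
Proof.
move=> T0 TS X [l [X_ [F_ [[X0 <- XF] FN]]]].
suff: forall j, (j <= l)%N -> T (X_ j) by apply.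
elim=> [_|j IH jl]; first exact: T0.
have [f [g fg]] := XF j jl.
by apply: TS fg (IH (ltnW jl)) (FN j jl).
Qed.

Lemma Filt_iso Ns X Y : iso X Y -> Filt Ns X -> Filt Ns Y.
Proof.
move=> XY FX; move: X FX Y XY.
apply: (@Filt_ind Ns (fun X => forall Y, iso X Y -> Filt Ns Y)).
  by move=> X X0 Y XY; apply/Filt_zero/(iso_is_zero XY).
move=> X0 X Z f g fg IH ZN Y [h hi].
have [f' [g' fg']] := short_exact_iso_mid fg hi.
exact: Filt_snoc fg' (IH _ (iso_refl X0)) ZN.
Qed.

(** A filtration of the quotient [Z] is pulled back to [Y], one layer at a time. *)
Lemma Filt_ext Ns X Y Z (f : jhom X Y) (g : jhom Y Z) :
  short_exact f g -> Filt Ns X -> Filt Ns Z -> Filt Ns Y.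
Proof.
move=> fg FX FZ; move: Z FZ X Y f g fg FX.
apply: (@Filt_ind Ns (fun Z => forall X Y (f : jhom X Y) (g : jhom Y Z),
  short_exact f g -> Filt Ns X -> Filt Ns Y)).
  by move=> Z Z0 X Y f g fg; apply: Filt_iso (short_exact_zeror fg Z0).
move=> Z1 Z N f g fg IH NN X Y h k hk FX.
have [Y1 [l [r [y [lr ygk]]]]] := short_exact_pullback hk fg.
exact: Filt_snoc ygk (IH _ _ _ _ lr FX) NN.
Qed.

Lemma Filt_mem Ns i : (i < size Ns)%N -> Filt Ns (nth_mod Ns i).
Proof.
have zz := is_zero_zero_mod P; move=> iN.
have [f [g fg]] := short_exact_0l zz (iso_refl (nth_mod Ns i)).
apply: Filt_snoc fg (Filt_zero _ zz) _.
by exists i => //; apply: iso_refl.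
Qed.

Lemma Filt_sub Ns Ns' X :
  (forall i, (i < size Ns)%N ->
     exists2 j, (j < size Ns')%N & nth_mod Ns' j = nth_mod Ns i) ->
  Filt Ns X -> Filt Ns' X.
Proof.
move=> sub; apply: Filt_ind X; first exact: Filt_zero.
move=> X Y Z f g fg FX [i /sub[j jN jE] Zi].
by apply: Filt_snoc fg FX _; exists j; rewrite ?jE.
Qed.

Lemma Filt_torsion Ns T X : torsion_class T ->
  (forall i, (i < size Ns)%N -> T (nth_mod Ns i)) -> Filt Ns X -> T X.
Proof.
move=> Ttors TN; have [_ Tiso _ Text] := Ttors.
apply: Filt_ind X => [X|X Y Z f g fg TX [i iN Zi]]; first exact: torsion_class_zero.
by apply: Text fg TX _; apply: Tiso (iso_sym Zi) (TN i iN).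
Qed.

End TorsionBricks.

(** * The torsion classes of a complete forward hom-orthogonal sequence *)

Section HomOrthogonal.
Set Implicit Arguments.
Unset Strict Implicit.
Variables (K : fieldType) (n : nat) (P : qpot K n).
Implicit Types (L M N X Y Z Q : jmod P) (Ns Ms : seq (jmod P)).

Lemma nth_mod_default Ns i : (size Ns <= i)%N -> nth_mod Ns i = zero_mod P.
Proof. exact: nth_default. Qed.

Definition sum_inl M N (u : M) : M * N := (u, 0).
Definition sum_inr M N (v : N) : M * N := (0, v).

Lemma sum_inl_linear M N : linear (@sum_inl M N).
Proof. by move=> c u v; rewrite /sum_inl; congr (_, _); rewrite /= scaler0 addr0. Qed.
HB.instance Definition _ M N := GRing.isLinear.Build K M (M * N)%type *:%R
  (@sum_inl M N) (@sum_inl_linear M N).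

Lemma sum_inr_linear M N : linear (@sum_inr M N).
Proof. by move=> c u v; rewrite /sum_inr; congr (_, _); rewrite /= scaler0 addr0. Qed.
HB.instance Definition _ M N := GRing.isLinear.Build K N (M * N)%type *:%R
  (@sum_inr M N) (@sum_inr_linear M N).

Lemma sum_mod_act M N x (u : sum_mod M N) :
  jact (sum_mod M N) x u = (jact M x u.1, jact N x u.2) :> (M * N)%type.
Proof. exact: lfunE. Qed.

Lemma hom_zero_sum_mod M N Y :
  hom_zero (sum_mod M N) Y <-> hom_zero M Y /\ hom_zero N Y.
Proof.
pose S := sum_mod M N.
have [|p pE] := @jhom_intro _ _ _ S M (linfun fst).
  by move=> x u; rewrite sum_mod_act !(@lfunE _ _ _ fst).
have [|q qE] := @jhom_intro _ _ _ S N (linfun snd).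
  by move=> x u; rewrite sum_mod_act !(@lfunE _ _ _ snd).
have [|i iE] := @jhom_intro _ _ _ M S (linfun (@sum_inl M N)).
  by move=> x u; rewrite sum_mod_act !(@lfunE _ _ _ (@sum_inl M N)) /= linear0.
have [|j jE] := @jhom_intro _ _ _ N S (linfun (@sum_inr M N)).
  by move=> x u; rewrite sum_mod_act !(@lfunE _ _ _ (@sum_inr M N)) /= linear0.
split=> [SY|[MY NY] f].
  split=> f; apply: jhom_ext => u; rewrite jhom0E.
    have /(congr1 (fun h : jhom S Y => h (i u))) := SY (jcomp f p).
    by rewrite jcompE jhom0E pE iE !lfunE.
  have /(congr1 (fun h : jhom S Y => h (j u))) := SY (jcomp f q).
  by rewrite jcompE jhom0E qE jE !lfunE.
apply: jhom_ext => u; rewrite jhom0E.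
have -> : u = i u.1 + j u.2.
  by rewrite iE jE !lfunE /=; case: u => a b; congr (_, _); rewrite /= ?addr0 ?add0r.
have fi : f (i u.1) = 0 by rewrite -jcompE (MY (jcomp f i)) jhom0E.
have fj : f (j u.2) = 0 by rewrite -jcompE (NY (jcomp f j)) jhom0E.
by rewrite linearD /= fi fj addr0.
Qed.

Lemma hom_zero_direct_sum Ns Y :
  hom_zero (direct_sum Ns) Y <-> forall i, hom_zero (nth_mod Ns i) Y.
Proof.
elim: Ns => [|N Ns IH] /=.
  split=> [_ i|_]; last exact/hom_zero_from0/is_zero_zero_mod.
  by rewrite nth_mod_default //; apply/hom_zero_from0/is_zero_zero_mod.
rewrite hom_zero_sum_mod IH; split=> [[NY NsY] [|i]|NY].
- exact: NY.
- exact: NsY i.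
- by split=> [|i]; [exact: NY 0%N | exact: NY i.+1].
Qed.

Lemma fho_insert Ns j X : (j <= size Ns)%N ->
  forward_hom_orthogonal Ns ->
  (forall i, (i < j)%N -> hom_zero (nth_mod Ns i) X) ->
  (forall i, (j <= i < size Ns)%N -> hom_zero X (nth_mod Ns i)) ->
  forward_hom_orthogonal (take j Ns ++ X :: drop j Ns).
Proof.
move=> jN NN NX XN.
have nthE i : nth_mod (take j Ns ++ X :: drop j Ns) i =
    if (i < j)%N then nth_mod Ns i else if i == j then X else nth_mod Ns i.-1.
  rewrite /nth_mod nth_cat size_takel //; case: ltngtP => [ij|ji|->].
  - by rewrite nth_take.
  - by case: i ji => // i ji; rewrite subSn //= nth_drop subnKC.
  - by rewrite subnn.
move=> i l; rewrite size_cat /= size_takel // size_drop addnS subnKC // => /andP[il lN].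
rewrite !nthE; case: (ltngtP l j) => [lj|jl|lj].
- by rewrite (ltn_trans il lj); apply: NN; rewrite il (leq_trans lj jN).
- have l1 : l.-1.+1 = l by rewrite prednK // (leq_ltn_trans _ jl).
  have l1N : (l.-1 < size Ns)%N by rewrite -ltnS l1.
  case: (ltngtP i j) => [ij|ji|ij].
  + by apply: NN; rewrite l1N (leq_trans ij) // -ltnS l1.
  + have i1 : i.-1.+1 = i by rewrite prednK // (leq_ltn_trans _ ji).
    by apply: NN; rewrite l1N -ltnS i1 l1 il.
  + by apply: XN; rewrite l1N -ltnS l1 jl.
- by subst l; rewrite il; apply: NX.
Qed.

Lemma fho_insertE Ns j X : (j <= size Ns)%N ->
  forward_hom_orthogonal (take j Ns ++ X :: drop j Ns) ->
  [/\ forward_hom_orthogonal Ns,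
      forall i, (i < j)%N -> hom_zero (nth_mod Ns i) X &
      forall i, (j <= i < size Ns)%N -> hom_zero X (nth_mod Ns i)].
Proof.
move=> jN; have nthl i : (i < j)%N ->
    nth_mod (take j Ns ++ X :: drop j Ns) i = nth_mod Ns i.
  by move=> ij; rewrite /nth_mod nth_cat size_takel // ij nth_take.
have nthm : nth_mod (take j Ns ++ X :: drop j Ns) j = X.
  by rewrite /nth_mod nth_cat size_takel // ltnn subnn.
have nthr i : (j <= i)%N ->
    nth_mod (take j Ns ++ X :: drop j Ns) i.+1 = nth_mod Ns i.
  move=> ji; rewrite /nth_mod nth_cat size_takel // ltnNge leqW //= subSn //=.
  by rewrite nth_drop subnKC.
have size1 : size (take j Ns ++ X :: drop j Ns) = (size Ns).+1.
  by rewrite size_cat /= size_takel // size_drop addnS subnKC.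
rewrite /forward_hom_orthogonal size1 => NN.
split=> [i l /andP[il lN]|i ij|i /andP[ji iN]].
- have [lj|jl] := ltnP l j.
    by rewrite -(nthl i) ?(ltn_trans il lj) // -(nthl l) //; apply: NN; rewrite il ltnW.
  have [ij|ji] := ltnP i j.
    by rewrite -(nthl i) // -(nthr l) //; apply: NN; rewrite !ltnS lN andbT ltnW.
  by rewrite -(nthr i) // -(nthr l) //; apply: NN; rewrite !ltnS il.
- by rewrite -(nthl i) // -{2}nthm; apply: NN; rewrite ij ltnS.
- by rewrite -(nthr i) // -{1}nthm; apply: NN; rewrite !ltnS ji.
Qed.

(** The torsion-free class of the torsion pair generated by the first [i] terms.
    Indices beyond the end of [Ms] contribute the zero module. *)
Definition torf Ms i : subcat P :=
  fun Y => forall j, (j < i)%N -> hom_zero (nth_mod Ms j) Y.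

(** The torsion class of the same pair. It is defined by orthogonality because the
    closure under quotients, which is not apparent on filtrations, is then
    immediate. *)
Definition tors Ms i : subcat P := fun X => forall Y, torf Ms i Y -> hom_zero X Y.

Lemma tors_torsion Ms i : torsion_class (tors Ms i).
Proof.
split=> [Y _|X X' XX' TX Y FY|X X' f ef TX Y FY h|X X' X'' f g fg TX TX'' Y FY h].
- exact/hom_zero_from0/is_zero_zero_mod.
- exact: hom_zero_iso XX' (iso_refl Y) (TX Y FY).
- exact: epic_comp_eq0 ef (TX Y FY _).
- have [u <-] := short_exact_factorr fg (TX Y FY (jcomp h f)).
  by rewrite (TX'' Y FY u) jcomp0l.
Qed.

Lemma torf_monic Ms i X Y (f : jhom X Y) : monic f -> torf Ms i Y -> torf Ms i X.
Proof. by move=> mf FY j ji h; apply: monic_comp_eq0 mf (FY j ji _). Qed.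

Lemma torf_ext Ms i X Y Z (f : jhom X Y) (g : jhom Y Z) :
  short_exact f g -> torf Ms i X -> torf Ms i Z -> torf Ms i Y.
Proof.
move=> fg FX FZ j ji h.
have [u <-] := short_exact_factorl fg (FZ j ji (jcomp g h)).
by rewrite (FX j ji u) jcomp0r.
Qed.

Lemma torf_le Ms i j Y : (i <= j)%N -> torf Ms j Y -> torf Ms i Y.
Proof. by move=> ij FY l li; apply: FY; apply: leq_trans ij. Qed.

Lemma tors_le Ms i j X : (i <= j)%N -> tors Ms i X -> tors Ms j X.
Proof. by move=> ij TX Y FY; apply/TX/(torf_le ij). Qed.

Lemma tors_mem Ms i j : (j < i)%N -> tors Ms i (nth_mod Ms j).
Proof. by move=> ji Y; apply. Qed.

Lemma tors_torf_zero Ms i X : tors Ms i X -> torf Ms i X -> is_zero X.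
Proof. by move=> TX FX; apply/jid0_is_zero/TX. Qed.

Lemma tors_part Ms i X : exists tX Q (f : jhom tX X) (q : jhom X Q),
  [/\ short_exact f q, tors Ms i tX & torf Ms i Q].
Proof.
have [tX [Q [f [q [fq TtX FQ]]]]] := torsion_part X (tors_torsion Ms i).
by exists tX, Q, f, q; split=> // j ji; apply/FQ/tors_mem.
Qed.

Section Complete.
Variables (Ms : seq (jmod P)) (cfhoM : complete_fho Ms).
Local Notation m := (size Ms).
Local Notation M_ := (nth_mod Ms).

Lemma tors_all X : tors Ms m X.
Proof.
have [_ _ _ genM] := cfhoM; move=> Y FY; apply: genM; apply/hom_zero_direct_sum => i.
have [iM|Mi] := ltnP i m; first exact: FY.
by rewrite nth_mod_default //; apply/hom_zero_from0/is_zero_zero_mod.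
Qed.

Lemma torf_mem i : (i < m)%N -> torf Ms i (M_ i).
Proof. by have [_ fhoM _ _] := cfhoM; move=> im j ji; apply: fhoM; rewrite ji. Qed.

(** A brick quotient of [X] has a nonzero map to [M_ i], for otherwise it could be
    inserted before [M_ i]. The image of this map is a torsion module, so it receives
    a nonzero map from [M_ i]; the composite is a nonzero endomorphism of the brick
    [M_ i], hence invertible, and the image is the whole of [M_ i]. *)
Lemma tors_torf_epic i X : (i < m)%N -> tors Ms i.+1 X -> torf Ms i X -> ~ is_zero X ->
  exists g : jhom X (M_ i), epic g.
Proof.
move=> im TX FX X0; have [bricksM fhoM maxM genM] := cfhoM.
have [B [q [j [Bb eq mj]]]] := brick_subquotient X0.
have [_ _ Tepi _] := tors_torsion Ms i.+1.
have TB := Tepi _ _ _ eq TX; have FB := torf_monic mj FX.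
have /existsNP[h h0] : ~ hom_zero B (M_ i).
  move=> BM; apply: (maxM B Bb (genM B) i (ltnW im)).
  apply: fho_insert => // [|l /andP[]]; first exact: ltnW.
  rewrite leq_eqVlt => /predU1P[<- //|il] lm; apply: TB.
  by move=> t ti; apply: fhoM; rewrite lm (leq_trans ti).
have [I [e [u [ee mu hE]]]] := image h.
have FI := torf_monic mu (torf_mem im); have TI := Tepi _ _ _ ee TB.
have I0 : ~ is_zero I by move=> I0; apply: h0; rewrite hE (hom_zero_to0 I0 e) jcomp0r.
have /existsNP[v v0] : ~ hom_zero (M_ i) I.
  move=> MI; apply/I0/(tors_torf_zero TI) => l; rewrite ltnS leq_eqVlt.
  by move=> /predU1P[-> //|]; apply: FI.
have /is_iso_monic_epic[_ /epicP euv] : is_iso (jcomp u v).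
  by apply: (bricksM i im).2 => uv0; apply/v0/(monic_comp_eq0 mu).
exists (jcomp h q); apply: epic_comp => //; apply/epicP => w.
have [x ->] := euv w; have [b bE] := proj1 (epicP e) ee (v x).
by exists b; rewrite hE !jcompE -bE.
Qed.

(** Let [L] be the kernel of an epimorphism [X -> M_ i], and [t] the torsion part of
    [L]. If [t] is nonzero, [X] is an extension of the smaller modules [X / t] and
    [t], which lie in the same slice. Otherwise [L] is torsion-free, any nonzero map
    [M_ i -> X] splits the epimorphism, and the torsion module [X] has no nonzero map
    to its summand [L], whence [X] is isomorphic to [M_ i]. *)
Lemma tors_torf_Filt i X : (i < m)%N -> tors Ms i.+1 X -> torf Ms i X ->
  Filt [:: M_ i] X.
Proof.
move=> im; have [_ _ Tepi Text] := tors_torsion Ms i.+1.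
have [d] := ubnP (mdim X); elim: d X => // d IH X dX TX FX.
have [X0|X0] := pselect (is_zero X); first exact: Filt_zero.
have [g eg] := tors_torf_epic im TX FX X0.
have [L [k kg]] := short_exact_epic eg.
have [t [Q [j [p [jp Tt FQ]]]]] := tors_part Ms i.+1 L.
have [mk _ _] := kg; have [mj _ ep] := jp.
have mkj := monic_comp mk mj.
have Ft := torf_monic mkj FX.
have [t0|t0] := pselect (is_zero t).
  have [bM _ _ _] := cfhoM.
  have LQ := short_exact_zerol jp t0.
  have FL : torf Ms i.+1 L.
    by move=> l li; apply: hom_zero_iso (iso_refl _) (iso_sym LQ) (FQ l li).
  have /existsNP[f f0] : ~ hom_zero (M_ i) X.
    move=> MX; apply/X0/(tors_torf_zero TX) => l; rewrite ltnS leq_eqVlt.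
    by move=> /predU1P[-> //|]; apply: FX.
  have [h [hgf gfh]] : is_iso (jcomp g f).
    apply: (bM i im).2 => gf0; apply: f0.
    by have [u <-] := short_exact_factorl kg gf0; rewrite (FL i (leqnn _) u) jcomp0r.
  have [v kv] : exists v : jhom X L, jcomp k v = jid X - jcomp f (jcomp h g).
    apply: (short_exact_factorl kg); apply: jhom_ext => x.
    have := congr1 (fun u : jhom (M_ i) (M_ i) => u (g x)) gfh.
    rewrite !jcompE jidE => gfhg; rewrite jhom0E jhomBE jidE !jcompE.
    by rewrite linearB /= gfhg subrr.
  have mg : monic g.
    apply: monic_eq0 => x gx; have := congr1 (fun u : jhom X X => u x) kv.
    rewrite (TX L FL v) jcomp0r jhom0E jhomBE jidE !jcompE gx !linear0.
    by rewrite addr0.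
  apply: Filt_iso (Filt_mem (Ns := [:: M_ i]) (i := 0) isT).
  by apply: iso_sym; exists g; apply/is_iso_monic_epic.
have [C [c [u [w [cE uw]]]]] := short_exact_pushout kg jp; have [_ _ ec] := cE.
have TC := Tepi _ _ _ ec TX.
have FC := torf_ext uw (torf_le (leqnSn i) FQ) (torf_mem im).
have [_ _ ew] := uw.
have C0 : ~ is_zero C.
  have [bM _ _ _] := cfhoM; move/(epic_is_zero ew).
  exact/brick_nonzero/bM.
move: dX; rewrite ltnS (short_exact_mdim cE) => dX.
apply: Filt_ext cE (IH t _ Tt Ft) (IH C _ TC FC); apply: leq_trans dX.
  by rewrite -[ltnLHS]addn0 ltn_add2l; apply/is_zero_mdim.
by rewrite -[ltnLHS]add0n ltn_add2r; apply/is_zero_mdim.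
Qed.

(** The successive torsion parts of [X] have their [j]-th subquotient in the slice
    [Filt [:: M_ j]], and vanish up to the index [i]. The two indices serve for the
    torsion classes (with [i = 0]) and for the torsion-free ones (with [l = m]). *)
Lemma tors_torf_Filt_drop i l X : (l <= m)%N -> tors Ms l X -> torf Ms i X ->
  Filt (drop i (take l Ms)) X.
Proof.
elim: l X => [|l IH] X lm TX FX.
  by apply/Filt_zero/(tors_torf_zero TX).
have [li|il] := leqP l.+1 i.
  by apply/Filt_zero/(tors_torf_zero TX)/(torf_le li).
have [t [Q [f [q [fq Tt FQ]]]]] := tors_part Ms l X.
have [mf _ eq] := fq; have [_ _ Tepi _] := tors_torsion Ms l.+1.
have Ft := torf_monic mf FX; have TQ := Tepi _ _ _ eq TX.
have size_l : size (take l.+1 Ms) = l.+1 by rewrite size_takel.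
have nthE j : (j + i < l.+1)%N -> nth_mod (drop i (take l.+1 Ms)) j = M_ (i + j).
  by move=> ji; rewrite /nth_mod nth_drop nth_take // addnC.
apply: Filt_ext fq _ _.
  apply: Filt_sub (IH t (ltnW lm) Tt Ft) => j.
  rewrite size_drop size_takel ?(ltnW lm) // ltn_subRL => ji.
  exists j; first by rewrite size_drop size_l ltn_subRL (leq_trans ji).
  by rewrite /nth_mod !nth_drop !nth_take ?(leq_trans ji).
apply: Filt_sub (tors_torf_Filt lm TQ FQ) => -[|//] _.
exists (l - i)%N; first by rewrite size_drop size_l ltn_sub2r.
by rewrite /nth_mod nth_drop nth_take subnKC.
Qed.

Lemma mgs_ofE i X : (i <= m)%N -> mgs_of Ms i X <-> tors Ms i X.
Proof.
move=> im; split=> [|TX]; last first.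
  by rewrite /mgs_of -[take i Ms]drop0; apply: tors_torf_Filt_drop.
apply: Filt_torsion => [|j]; first exact: tors_torsion.
by rewrite size_takel // => ji; rewrite /nth_mod nth_take //; apply: tors_mem.
Qed.

Lemma torsion_class_eq (T T' : subcat P) :
  (forall X, T X <-> T' X) -> torsion_class T -> torsion_class T'.
Proof.
move=> TT' [T0 Tiso Tepi Text]; split.
- exact/TT'.
- by move=> X Y XY /TT' TX; apply/TT'/(Tiso _ _ XY).
- by move=> X Y f ef /TT' TX; apply/TT'/(Tepi _ _ _ ef).
- by move=> X Y Z f g fg /TT' TX /TT' TZ; apply/TT'/(Text _ _ _ _ _ fg).
Qed.

(** If a torsion class strictly contains [tors Ms i] and is contained in
    [tors Ms i.+1], the torsion-free part of one of its modules is a nonzero module of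
    the slice, which surjects onto [M_ i]; so this class contains [M_ i] too. *)
Lemma mgs_of_cfho : maximal_green_sequence m (mgs_of Ms).
Proof.
split=> [X|X|i im].
- split=> [/mgs_ofE TX|X0]; last exact: Filt_zero.
  exact: tors_torf_zero (TX (leq0n _)) _.
- exact/mgs_ofE/tors_all.
have [bM _ _ _] := cfhoM.
have tE j : (j <= m)%N -> torsion_class (mgs_of Ms j).
  move=> jm; apply: torsion_class_eq (tors_torsion Ms j) => X.
  by have := mgs_ofE X jm; tauto.
split; [exact/tE/ltnW | exact: tE | split |].
- by move=> X /(mgs_ofE _ (ltnW im)) TX; apply/mgs_ofE/(tors_le (leqnSn i)).
- move=> /(_ (M_ i))[_ MT].
  have MM := proj2 (mgs_ofE _ im) (tors_mem (leqnn _)).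
  have TM := proj1 (mgs_ofE _ (ltnW im)) (MT MM).
  exact: brick_nonzero (bM i im) (tors_torf_zero TM (torf_mem im)).
move=> T Ttors [[sT nT] [sT' nT']]; apply: nT' => X; split; first exact: sT'.
have [_ _ Tepi _] := Ttors; have [_ _ Tepi' _] := tors_torsion Ms i.+1.
have TM : T (M_ i).
  have /existsNP[Y /not_implyP[TY nTY]] : ~ forall Y, T Y -> mgs_of Ms i Y.
    by move=> h; apply: nT => Y; split; [apply: sT | apply: h].
  have [t [Q [f [q [fq Tt FQ]]]]] := tors_part Ms i Y; have [_ _ eq] := fq.
  have Q0 : ~ is_zero Q.
    move=> Q0; apply/nTY/mgs_ofE; first exact: ltnW.
    have [_ Tiso _ _] := tors_torsion Ms i.
    exact: Tiso (short_exact_zeror fq Q0) Tt.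
  have TY' : tors Ms i.+1 Y by apply/(mgs_ofE _ im)/sT'.
  have [g eg] := tors_torf_epic im (Tepi' _ _ _ eq TY') FQ Q0.
  exact: Tepi eg (Tepi _ _ _ eq TY).
apply: Filt_torsion => // j; rewrite size_takel // ltnS /nth_mod => ji.
rewrite nth_take // -/(M_ j); move: ji; rewrite leq_eqVlt => /predU1P[-> //|ji].
by apply/sT/mgs_ofE; [exact: ltnW | exact: tors_mem].
Qed.

End Complete.
End HomOrthogonal.

(** * Dimension vectors and phases *)

Section DimensionVectors.
Set Implicit Arguments.
Unset Strict Implicit.
Variables (K : fieldType) (n : nat) (P : qpot K n).
Implicit Types (L M N : jmod P).

Lemma vertexE (i j : 'I_n) (s : seq (arrow P)) : is_path (j, s) ->
  coef (vertex K P i) (j, s) = ((j == i) && (s == [::]))%:R.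
Proof. by move=> jsP; rewrite coef_monom. Qed.

Lemma vertexM (i : 'I_n) : vertex K P i * vertex K P i = vertex K P i.
Proof.
apply: cpa_ext => -[j s] jsP; rewrite [in LHS]coef_mul.
have coef0 (l : 'I_n) (t : seq (arrow P)) : t != [::] -> coef (vertex K P i) (l, t) = 0.
  move=> t0; have [ltP|/coef_out //] := boolP (is_path (l, t)).
  by rewrite vertexE // (negPf t0) andbF.
have [->|s0] := eqVneq s [::].
  by rewrite big_nat1 /= vertexE // andbT; case: eqP; rewrite ?mulr1 ?mulr0.
rewrite big1_seq ?coef0 // => l /andP[_]; rewrite mem_index_iota ltnS => /= ls.
have [l0|l0] := posnP l; first by rewrite l0 drop0 (coef0 _ s) // mulr0.
rewrite coef0 ?mul0r // -size_eq0 size_takel //; by case: l l0 {ls}.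
Qed.

Lemma sum_vertex : \sum_i vertex K P i = 1.
Proof.
have coef_sum (x : word P) : is_path x ->
    coef (\sum_i vertex K P i) x = \sum_i coef (vertex K P i) x.
  by move=> xP; elim/big_rec2: _ => [|i y u _ <-]; rewrite ?coefD // /coef insubT.
apply: cpa_ext => -[j s] jsP; rewrite coef_sum // coef_one //=.
rewrite (bigD1 j) //= vertexE // eqxx big1 ?addr0 // => i ij.
by rewrite vertexE // eq_sym (negPf ij).
Qed.

Definition idem (i : 'I_n) : jacobian P := jac_pi (vertex K P i).

Lemma idemM i : idem i * idem i = idem i.
Proof. by rewrite -[LHS]jac_piM vertexM. Qed.

Lemma sum_idem : \sum_i idem i = 1.
Proof.
by rewrite -[RHS]/(jac_pi 1) -sum_vertex (big_morph _ (@jac_piD K n P) (raddf0 _)).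
Qed.

Lemma dim_vectorE M i : dim_vector M i 0 = (\dim (limg (jact M (idem i))))%:Z.
Proof. exact: mxE. Qed.

Lemma jact_idem M i v : jact M (idem i) (jact M (idem i) v) = jact M (idem i) v.
Proof. by rewrite -[in RHS]idemM jactM comp_lfunE. Qed.

(** The functor [M |-> e_i M] is exact since [e_i] is idempotent: an element [f u] of
    [e_i M] is [f (e_i u)]. *)
Lemma dim_vector_short_exact L M N (f : jhom L M) (g : jhom M N) :
  short_exact f g -> dim_vector M = dim_vector L + dim_vector N.
Proof.
move=> [mf fg eg]; apply/matrixP => i j; rewrite (ord1 j) [RHS]mxE !dim_vectorE.
rewrite -PoszD; congr Posz; rewrite -(limg_ker_dim g); congr (_ + _)%N.
  rewrite -(limg_dim_eq (f := f)); last by rewrite (eqP mf) capv0.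
  congr (\dim _); apply/vspaceP => w; apply/memv_capP/memv_imgP => [[]|].
    move=> /memv_imgP[v _ wE]; rewrite memv_ker => /eqP gw.
    have [u uE] := proj1 (proj1 (exact_atP f g) fg w) gw.
    exists (jact L (idem i) u); first by rewrite memv_img ?memvf.
    by rewrite jhom_act -uE wE jact_idem.
  move=> [u /memv_imgP[x _ ->] ->]; split.
    by rewrite jhom_act memv_img ?memvf.
  by rewrite memv_ker; apply/eqP/(proj1 (exact_atP f g) fg); eexists.
apply: congr1; apply/vspaceP => w; apply/memv_imgP/memv_imgP.
  move=> [v /memv_imgP[x _ ->] ->].
  by exists (g x); rewrite ?memvf // jhom_act.
move=> [y _ ->]; have [x ->] := proj1 (epicP g) eg y.
by exists (jact M (idem i) x); rewrite ?memv_img ?memvf // jhom_act.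
Qed.

Lemma dim_vector_zero M : is_zero M -> dim_vector M = 0.
Proof.
move=> M0; apply/matrixP => i j; rewrite (ord1 j) dim_vectorE [RHS]mxE.
apply/eqP; rewrite eqz_nat -leqn0 -M0; exact/dimvS/subvf.
Qed.

Lemma dim_vector_iso M N : iso M N -> dim_vector M = dim_vector N.
Proof.
move=> MN; have [f [g fg]] := short_exact_0l (is_zero_zero_mod P) MN.
by rewrite (dim_vector_short_exact fg) (dim_vector_zero (is_zero_zero_mod P)) add0r.
Qed.

Lemma dim_vector_simple (k : 'I_n) : dim_vector (simple P k) = delta_mx k 0.
Proof.
apply/matrixP => i j; rewrite (ord1 j) dim_vectorE [RHS]mxE eqxx andbT.
have actE v : jact (simple P k) (idem i) v = (k == i)%:R * v.
  rewrite /= /simple_act coef_repr vertexE // andbT scale_lfunE id_lfunE //.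
rewrite eq_sym; case: eqVneq => [ki|ki] in actE *.
  have -> : jact (simple P k) (idem i) = \1%VF.
    by apply/lfunP => v; rewrite actE id_lfunE mul1r.
  by rewrite lim1g dimvf /dim /=.
have -> : jact (simple P k) (idem i) = 0.
  by apply/lfunP => v; rewrite actE zero_lfunE mul0r.
by rewrite lim0g dimv0.
Qed.

Variables (R : realType).
Implicit Types (theta b : 'cV[R]_n).

Lemma pairingD theta d d' : pairing theta (d + d') = pairing theta d + pairing theta d'.
Proof.
by rewrite /pairing -big_split; apply: eq_bigr => i _; rewrite mxE rmorphD mulrDr.
Qed.

(** If all the [e_i] act as zero on [M], so does their sum [1]. *)
Lemma pairing_gt0 b M : (forall i, 0 < b i 0) -> ~ is_zero M ->
  0 < pairing b (dim_vector M).
Proof.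
move=> b0 M0; rewrite lt0r; have ge0 i : 0 <= b i 0 * (dim_vector M i 0)%:~R.
  by apply: mulr_ge0; [exact: ltW | rewrite dim_vectorE ler0z].
rewrite sumr_ge0 ?andbT // psumr_eq0 // ; apply: contra_notN M0 => /allP d0.
apply/is_zeroP => v; rewrite -[v]id_lfunE -jact1 -sum_idem linear_sum sum_lfunE.
apply: big1 => i _; apply/eqP; rewrite -memv0.
have := d0 i (mem_index_enum i); rewrite mulf_eq0 gt_eqF ?b0 //=.
by rewrite dim_vectorE intr_eq0 eqz_nat dimv_eq0 => /eqP <-; rewrite memv_img ?memvf.
Qed.

End DimensionVectors.

Section Phase.
Set Implicit Arguments.
Unset Strict Implicit.
Variables (R : realType).
Implicit Types (a b c d s t : R).

(** The cosine of the argument of [s + i] is [s / sqrt (1 + s ^ 2)]; this is the fact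
    that it increases with [s]. *)
Lemma div_hypot_lt s t : s < t ->
  s * Num.sqrt (1 + t ^+ 2) < t * Num.sqrt (1 + s ^+ 2).
Proof.
move=> st; have sq x : Num.sqrt (1 + x ^+ 2) ^+ 2 = 1 + x ^+ 2 :> R.
  by rewrite sqr_sqrtr // addr_ge0 // sqr_ge0.
have sq0 x : 0 < Num.sqrt (1 + x ^+ 2) :> R.
  by rewrite sqrtr_gt0 ltr_wpDr // sqr_ge0.
have := sq s; have := sq t; have := sq0 s; have := sq0 t.
move: (Num.sqrt _) (Num.sqrt _) => q p q0 p0 qE pE.
have [s0|s0] := leP 0 s.
  have t0 : 0 < t := le_lt_trans s0 st.
  rewrite -(ltr_pXn2r (n := 2)) ?nnegrE ?mulr_ge0 // ?ltW // !exprMn qE pE.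
  by rewrite !mulrDr !mulr1 [t ^+ 2 * _]mulrC ltrD2r ltr_pXn2r // nnegrE ltW.
have [t0|t0] := leP 0 t.
  by apply: (@lt_le_trans _ _ 0); [rewrite nmulr_rlt0 | rewrite mulr_ge0 // ltW].
rewrite -ltrN2 -!mulNr.
rewrite -(ltr_pXn2r (n := 2)) ?nnegrE ?mulr_ge0 ?oppr_ge0 // ?ltW // !exprMn qE pE.
rewrite !sqrrN !mulrDr !mulr1 [t ^+ 2 * _]mulrC ltrD2r.
rewrite -[X in X < _]sqrrN -[X in _ < X]sqrrN ltr_pXn2r //; last 2 first.
- by rewrite nnegrE oppr_ge0 ltW.
- by rewrite nnegrE oppr_ge0 ltW // (lt_trans st).
by rewrite ltrN2.
Qed.

Lemma cos_Arg a b : 0 < b ->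
  a / Normc.normc (a +i* b)%C = (a / b) / Num.sqrt (1 + (a / b) ^+ 2).
Proof.
move=> b0; rewrite /=; have -> : a ^+ 2 + b ^+ 2 = (1 + (a / b) ^+ 2) * b ^+ 2.
  by rewrite exprMn exprVn mulrDl mul1r divfK ?expf_neq0 ?gt_eqF // addrC.
rewrite sqrtrM ?addr_ge0 ?sqr_ge0 // sqrtr_sqr gtr0_norm // invfM.
by rewrite [_ * b^-1]mulrC mulrA.
Qed.

Lemma Arg_upper a b : 0 < b -> Arg (a +i* b)%C = acos (a / Normc.normc (a +i* b)%C).
Proof. by move=> b0; rewrite /Arg /= ltW. Qed.

Lemma hypot_gt a b : 0 < b -> `|a| < Num.sqrt (a ^+ 2 + b ^+ 2).
Proof.
move=> b0; rewrite -sqrtr_sqr ltr_sqrt; first by rewrite ltrDl exprn_gt0.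
by rewrite ltr_wpDl ?sqr_ge0 ?exprn_gt0.
Qed.

Lemma cos_Arg_itv a b : 0 < b -> -1 < a / Normc.normc (a +i* b)%C < 1.
Proof.
move=> b0; have := hypot_gt a b0; rewrite -ltr_norml /= => ab.
have s0 := le_lt_trans (normr_ge0 a) ab.
by rewrite normrM normfV (gtr0_norm s0) ltr_pdivrMr // mul1r.
Qed.

Lemma Arg_lt a b c d : 0 < b -> 0 < d ->
  (Arg (a +i* b)%C < Arg (c +i* d)%C) = (c / d < a / b).
Proof.
move=> b0 d0; rewrite !Arg_upper //.
have := cos_Arg_itv a b0; have := cos_Arg_itv c d0.
have mono s t : (s / Num.sqrt (1 + s ^+ 2) < t / Num.sqrt (1 + t ^+ 2)) = (s < t).
  have sq0 x : 0 < Num.sqrt (1 + x ^+ 2) :> R.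
    by rewrite sqrtr_gt0 ltr_wpDr // sqr_ge0.
  have homo (x y : R) : x < y -> x / Num.sqrt (1 + x ^+ 2) < y / Num.sqrt (1 + y ^+ 2).
    by move=> xy; rewrite ltr_pdivrMr // mulrAC ltr_pdivlMr // div_hypot_lt.
  apply/idP/idP => [|/homo //]; rewrite !ltNge; apply: contra.
  by rewrite le_eqVlt => /predU1P[-> //|/homo/ltW].
rewrite -(mono (c / d)) -(cos_Arg a b0) -(cos_Arg c d0).
move: (c / Normc.normc _) (a / Normc.normc _) => y x /andP[y1 y2] /andP[x1 x2].
have itv (z : R) : -1 < z -> z < 1 -> (acos z \in `[0, pi]%R) /\ (z \in `[-1, 1]%R).
  move=> z1 z2; have z12 : -1 <= z <= 1 by rewrite !ltW.
  by rewrite !in_itv /= z12 acos_ge0 // acos_lepi.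
have [[ax xi] [ay yi]] := (itv x x1 x2, itv y y1 y2).
by rewrite -ltr_cos // !acosK.
Qed.

Lemma Arg_itv a b : 0 < b -> 0 <= Arg (a +i* b)%C < pi.
Proof.
move=> b0; rewrite Arg_upper //; have /andP[x1 x2] := cos_Arg_itv a b0.
by rewrite acos_ge0 ?acos_ltpi // ?x1 ltW // ltW.
Qed.

Variables (K : fieldType) (n : nat) (P : qpot K n) (Z : central_charge R n).
Implicit Types (L M N X Y : jmod P).

Definition slope X :=
  pairing (re_charge Z) (dim_vector X) / pairing (im_charge Z) (dim_vector X).

Lemma phase_lt X Y : ~ is_zero X -> ~ is_zero Y ->
  (phase Z X < phase Z Y) = (slope Y < slope X).
Proof.
move=> X0 Y0; rewrite /phase ltr_pM2r ?invr_gt0 ?pi_gt0 // Arg_lt //.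
  exact/pairing_gt0/X0/im_charge_gt0.
exact/pairing_gt0/Y0/im_charge_gt0.
Qed.

Lemma phase_le X Y : ~ is_zero X -> ~ is_zero Y ->
  (phase Z X <= phase Z Y) = (slope Y <= slope X).
Proof. by move=> X0 Y0; rewrite !leNgt phase_lt. Qed.

Lemma phase_itv X : ~ is_zero X -> 0 <= phase Z X < 1.
Proof.
move=> X0; have := Arg_itv (pairing (re_charge Z) (dim_vector X))
  (pairing_gt0 (@im_charge_gt0 _ _ Z) X0).
by move=> /andP[a0 a1]; rewrite /phase divr_ge0 ?pi_ge0 //= ltr_pdivrMr ?pi_gt0 // mul1r.
Qed.

Lemma phase_iso X Y : iso X Y -> phase Z X = phase Z Y.
Proof. by move=> /dim_vector_iso XY; rewrite /phase XY. Qed.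

(** This has the sign of [slope X - c], but is additive on short exact sequences. *)
Definition excess c X := pairing (re_charge Z) (dim_vector X) -
  c * pairing (im_charge Z) (dim_vector X).

Lemma excess_short_exact c L M N (f : jhom L M) (g : jhom M N) :
  short_exact f g -> excess c M = excess c L + excess c N.
Proof.
by move=> /dim_vector_short_exact dM; rewrite /excess dM !pairingD; ring.
Qed.

Lemma excess_zero c X : is_zero X -> excess c X = 0.
Proof.
move=> /dim_vector_zero d0; rewrite /excess d0 /pairing.
by rewrite !big1 ?mulr0 ?subr0 // => i _; rewrite mxE mulr0.
Qed.

Lemma excess_ge0 c X : ~ is_zero X -> (0 <= excess c X) = (c <= slope X).
Proof.
by move=> X0; rewrite subr_ge0 ler_pdivlMr // pairing_gt0 //; apply: im_charge_gt0.
Qed.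

Lemma excess_le0 c X : ~ is_zero X -> (excess c X <= 0) = (slope X <= c).
Proof.
by move=> X0; rewrite subr_le0 ler_pdivrMr // pairing_gt0 //; apply: im_charge_gt0.
Qed.

End Phase.

(** * Stability functions inducing a maximal green sequence *)

Section Induced.
Set Implicit Arguments.
Unset Strict Implicit.
Variables (R : realType) (K : fieldType) (n : nat) (P : qpot K n).
Variable Z : central_charge R n.
Implicit Types (L M N X Y Q : jmod P) (Ns : seq (jmod P)).

Lemma excess_Filt_ge0 c Ns X :
  (forall i, (i < size Ns)%N -> 0 <= excess Z c (nth_mod Ns i)) ->
  Filt Ns X -> 0 <= excess Z c X.
Proof.
move=> N0; apply: (@Filt_ind _ _ _ Ns (fun X => 0 <= excess Z c X)) =>
  [{}X X0|L {}X N f g fg L0 [i iN Ni]].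
  by rewrite excess_zero.
by rewrite (excess_short_exact _ _ fg) addr_ge0 // /excess (dim_vector_iso Ni) N0.
Qed.

Lemma excess_Filt_le0 c Ns X :
  (forall i, (i < size Ns)%N -> excess Z c (nth_mod Ns i) <= 0) ->
  Filt Ns X -> excess Z c X <= 0.
Proof.
move=> N0; apply: (@Filt_ind _ _ _ Ns (fun X => excess Z c X <= 0)) =>
  [{}X X0|L {}X N f g fg L0 [i iN Ni]].
  by rewrite excess_zero.
rewrite (excess_short_exact _ _ fg) -[0]addr0 lerD //.
by rewrite /excess (dim_vector_iso Ni); apply: N0.
Qed.

(** The seesaw property: the excess of [L] over the slope of [X] is nonnegative, and
    it adds up to zero with that of [Q]. *)
Lemma semistable_quotient_phase L X Q (f : jhom L X) (g : jhom X Q) :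
  semistable Z X -> short_exact f g -> ~ is_zero Q -> phase Z X <= phase Z Q.
Proof.
move=> [X0 Xss] fg Q0; have [L0|L0] := pselect (is_zero L).
  by rewrite (phase_iso Z (short_exact_zerol fg L0)).
have [mf _ _] := fg; have := Xss L f L0 mf.
rewrite !phase_le // -excess_ge0 // -excess_le0 // => eL.
have: excess Z (slope Z X) X = 0.
  by apply/le_anti; rewrite excess_ge0 // excess_le0 // lexx.
rewrite (excess_short_exact _ _ fg) => /eqP; rewrite addrC addr_eq0 => /eqP ->.
by rewrite oppr_le0.
Qed.

Lemma hn_filtration_semistable X : semistable Z X ->
  exists X_ F_ : nat -> jmod P, hn_filtration Z X 1 X_ F_ /\ F_ 0%N = X.
Proof.
move=> Xss; have zz := is_zero_zero_mod P.
have [f [g fg]] := short_exact_0l zz (iso_refl X).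
have z0 : filtration (zero_mod P) 0 (fun=> zero_mod P) (fun=> X) by split.
have XF := filtration_snoc z0 fg; do 2!eexists; split; first by split; first exact: XF.
by [].
Qed.

Lemma hn_filtration_snoc L X Q (l : nat) (L_ F_ : nat -> jmod P)
    (f : jhom L X) (g : jhom X Q) :
  hn_filtration Z L l.+1 L_ F_ -> short_exact f g -> semistable Z Q ->
  phase Z Q < phase Z (F_ l) ->
  exists X_ F'_ : nat -> jmod P, hn_filtration Z X l.+2 X_ F'_ /\ F'_ l.+1 = Q.
Proof.
move=> [LF Fss Fdec] fg Qss QF; have XF := filtration_snoc LF fg.
do 2!eexists; split; [split; first exact: XF | by rewrite /= ltnn].
- move=> j jl /=; case: ifP => [|_] //; exact: Fss.
- move=> j; rewrite ltnS => jl /=; rewrite jl; case: ifP => [j1l|/negbT].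
    exact: Fdec.
  rewrite -leqNgt => lj; suff -> : j = l by [].
  by apply/eqP; rewrite eqn_leq -ltnS jl -ltnS.
Qed.

Section Complete.
Variables (Ms : seq (jmod P)) (cfhoM : complete_fho Ms).
Local Notation m := (size Ms).
Local Notation M_ := (nth_mod Ms).
Hypothesis slopeM : forall i j, (i < j < m)%N -> slope Z (M_ i) < slope Z (M_ j).

Lemma cfho_nonzero i : (i < m)%N -> ~ is_zero (M_ i).
Proof. by have [bM _ _ _] := cfhoM; move=> im; apply/brick_nonzero/bM. Qed.

(** A module of [torf Ms i] is filtered by [M_ i], ..., [M_ m.-1], the smallest slope
    among which is that of [M_ i]. *)
Lemma torf_slope i X : (i < m)%N -> torf Ms i X -> ~ is_zero X ->
  slope Z (M_ i) <= slope Z X.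
Proof.
move=> im FX X0; rewrite -excess_ge0 //.
have TX : tors Ms m X by apply: tors_all.
have := tors_torf_Filt_drop cfhoM (leqnn m) TX FX.
rewrite take_size; apply: excess_Filt_ge0 => j; rewrite size_drop ltn_subRL => ijm.
have -> : nth_mod (drop i Ms) j = M_ (i + j) by rewrite /nth_mod nth_drop.
rewrite excess_ge0; last exact: cfho_nonzero.
case: j ijm => [|j] ijm; first by rewrite addn0.
by apply/ltW/slopeM; rewrite ijm addnS ltnS leq_addr.
Qed.

Lemma tors_torf_slope i X : (i < m)%N -> tors Ms i.+1 X -> torf Ms i X -> ~ is_zero X ->
  slope Z X = slope Z (M_ i).
Proof.
move=> im TX FX X0; apply/le_anti; rewrite (torf_slope im FX X0) andbT.
rewrite -excess_le0 //.
apply: excess_Filt_le0 (tors_torf_Filt cfhoM im TX FX) => -[|//] _.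
by rewrite excess_le0 //; apply: cfho_nonzero.
Qed.

(** The submodules of [X] remain in [torf Ms i]. *)
Lemma tors_torf_semistable i X : (i < m)%N -> tors Ms i.+1 X -> torf Ms i X ->
  ~ is_zero X -> semistable Z X.
Proof.
move=> im TX FX X0; split=> // L f L0 mf.
rewrite phase_le // (tors_torf_slope im TX FX X0) torf_slope //.
exact: torf_monic mf FX.
Qed.

(** The torsion parts of [X], once the repetitions are removed, form its
    Harder-Narasimhan filtration; the last subquotient lies in the slice of some [M_ j],
    which determines its phase. *)
Lemma tors_hn i X : (i <= m)%N -> tors Ms i X -> ~ is_zero X ->
  exists (l : nat) (X_ F_ : nat -> jmod P), hn_filtration Z X l.+1 X_ F_ /\
    exists2 j, (j < i)%N & tors Ms j.+1 (F_ l) /\ torf Ms j (F_ l).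
Proof.
elim: i X => [|i IH] X im TX X0; first by case: X0; apply: tors_torf_zero TX _.
have [t [Q [f [q [fq Tt FQ]]]]] := tors_part Ms i X; have [mf _ eq] := fq.
have [_ Tiso Tepi _] := tors_torsion Ms i.+1; have TQ := Tepi _ _ _ eq TX.
have [Q0|Q0] := pselect (is_zero Q).
  have [_ Tiso' _ _] := tors_torsion Ms i.
  have [l [X_ [F_ [XF [j ji FF]]]]] :=
    IH X (ltnW im) (Tiso' _ _ (short_exact_zeror fq Q0) Tt) X0.
  by exists l, X_, F_; split=> //; exists j => //; apply: ltnW.
have Qss := tors_torf_semistable im TQ FQ Q0.
have [t0|t0] := pselect (is_zero t).
  have XQ := iso_sym (short_exact_zerol fq t0).
  have FX : torf Ms i X.
    by move=> j ji; apply: hom_zero_iso (iso_refl _) XQ (FQ j ji).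
  have [X_ [F_ [XF FE]]] := hn_filtration_semistable (tors_torf_semistable im TX FX X0).
  by exists 0%N, X_, F_; split=> //; exists i; rewrite ?FE.
have [l [X_ [F_ [tF [j ji [TF FF]]]]]] := IH t (ltnW im) Tt t0.
have [|X'_ [F'_ [XF' F'E]]] := hn_filtration_snoc tF fq Qss.
  have [F0 _] : semistable Z (F_ l) by have [_ Fss _] := tF; apply: Fss.
  rewrite phase_lt // (tors_torf_slope im TQ FQ Q0).
  by rewrite (tors_torf_slope (ltn_trans ji im) TF FF F0) slopeM // ji.
by exists l.+1, X'_, F'_; split=> //; exists i; rewrite ?F'E.
Qed.

(** The torsion-free quotient [Q] of [X], were it nonzero, would have phase at least
    that of [X], as a quotient, and at most that of [M_ i], as a torsion-free module. *)
Lemma semistable_tors i X : (i <= m)%N -> semistable Z X ->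
  (forall j, (i <= j < m)%N -> phase Z (M_ j) < phase Z X) -> tors Ms i X.
Proof.
move=> im Xss Xi; have [t [Q [f [q [fq Tt FQ]]]]] := tors_part Ms i X.
have [_ Tiso _ _] := tors_torsion Ms i.
have [Q0|Q0] := pselect (is_zero Q); first exact: Tiso (short_exact_zeror fq Q0) Tt.
move: im; rewrite leq_eqVlt => /predU1P[iE|im]; first by rewrite iE; apply: tors_all.
have := lt_le_trans (Xi i _) (semistable_quotient_phase Xss fq Q0).
rewrite leqnn im => /(_ isT); rewrite phase_lt //; last exact: cfho_nonzero.
by rewrite ltNge torf_slope.
Qed.

(** A module whose last Harder-Narasimhan subquotient has phase at least [r] has all
    of them of phase at least [r], hence in [tors Ms i]. *)
Lemma torsion_geE (r : R) i : (i <= m)%N ->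
  (forall j, (j < i)%N -> r <= phase Z (M_ j)) ->
  (forall j, (i <= j < m)%N -> phase Z (M_ j) < r) ->
  forall X, torsion_ge Z r X <-> tors Ms i X.
Proof.
move=> im ri ir X; have Ttors := tors_torsion Ms i; split.
  move=> [|[F [l [X_ [F_ [[[X0 XE XF] Fss Fdec] <-]]]] rF]].
    exact: torsion_class_zero.
  have [_ _ _ Text] := Ttors.
  have Fr j : (j <= l)%N -> r <= phase Z (F_ (l - j)%N).
    elim: j => [|j IH] jl; first by rewrite subn0.
    apply/(le_trans (IH (ltnW jl)))/ltW.
    have lj : (l - j = (l - j.+1).+1)%N by rewrite subnSK.
    by rewrite lj; apply: Fdec; rewrite -lj ltnS leq_subr.
  suff: forall j, (j <= l.+1)%N -> tors Ms i (X_ j).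
    by move=> /(_ _ (leqnn _)); rewrite XE.
  elim=> [_|j IH jl]; first exact: torsion_class_zero.
  have [f [g fg]] := XF j jl; apply: Text fg (IH (ltnW jl)) _.
  apply: semistable_tors => // [|t ti]; first exact: Fss.
  apply: lt_le_trans (ir t ti) _.
  by have := Fr (l - j)%N (leq_subr _ _); rewrite subKn.
move=> TX; have [X0|X0] := pselect (is_zero X); [by left | right].
have [l [X_ [F_ [XF [j ji [TF FF]]]]]] := tors_hn im TX X0.
exists (F_ l); first by exists l, X_, F_.
have [F0 _] : semistable Z (F_ l) by have [_ Fss _] := XF; apply: Fss.
have jm := leq_trans ji im.
apply: le_trans (ri j ji) _; rewrite phase_le //; last exact: cfho_nonzero.
by rewrite (tors_torf_slope jm TF FF F0).
Qed.

Lemma cfho_phase_lt i j : (i < j < m)%N -> phase Z (M_ j) < phase Z (M_ i).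
Proof.
move=> ijm; have /andP[ij jm] := ijm.
by rewrite phase_lt ?slopeM //; apply: cfho_nonzero; rewrite // (ltn_trans ij).
Qed.

Lemma mgs_of_induced : mgs_induced_by m (mgs_of Ms) Z.
Proof.
split; first exact: mgs_of_cfho.
  (* The phases decrease, so the terms of phase at least [r] are the first [i]. *)
  move=> r _; pose i := find (fun N => phase Z N < r) Ms.
  have im : (i <= m)%N := find_size _ _.
  exists i => // X; rewrite mgs_ofE //; apply: torsion_geE => // [j ji|j /andP[ij jm]].
    by have := before_find (zero_mod P) ji; rewrite /= leNgt => ->.
  have ri : phase Z (M_ i) < r.
    apply: (nth_find (zero_mod P) (a := fun N => phase Z N < r)).
    by rewrite has_find (leq_ltn_trans ij).
  move: ij; rewrite leq_eqVlt => /predU1P[<- //|ij].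
  by apply: lt_trans ri; apply: cfho_phase_lt; rewrite ij.
case=> [_|i im].
  (* All phases are less than 1, because the imaginary parts are positive. *)
  exists 1; first by rewrite ler01 lexx.
  move=> X; rewrite mgs_ofE //; apply: iff_sym; apply: torsion_geE => // j /andP[_ jm].
  by have /andP[] := phase_itv Z (cfho_nonzero jm).
exists (phase Z (M_ i)).
  by have /andP[-> /ltW ->] := phase_itv Z (cfho_nonzero im).
move=> X; rewrite mgs_ofE //; apply: iff_sym; apply: torsion_geE => // [j|j /andP[ij jm]].
  rewrite ltnS leq_eqVlt => /predU1P[-> //|ji].
  by apply/ltW/cfho_phase_lt; rewrite ji.
by apply: cfho_phase_lt; rewrite ij.
Qed.

End Complete.
End Induced.

(** * Simple modules and equivalences of subcategories *)

Section SimpleModules.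
Set Implicit Arguments.
Unset Strict Implicit.
Variables (K : fieldType) (n : nat) (P : qpot K n).
Implicit Types (L X Y : jmod P) (k : 'I_n).

Lemma mdim_simple k : mdim (simple P k) = 1%N.
Proof. by rewrite /mdim dimvf. Qed.

Lemma simple_nonzero k : ~ is_zero (simple P k).
Proof. by apply/is_zero_mdim; rewrite mdim_simple. Qed.

Lemma to_simple_epic k X (f : jhom X (simple P k)) : f <> 0 -> epic f.
Proof.
move=> f0; have [I [e [i [ee mi fE]]]] := image f.
have I0 : ~ is_zero I by move=> I0; apply: f0; rewrite fE (hom_zero_to0 I0 e) jcomp0r.
have /is_iso_monic_epic[_ ei] : is_iso i.
  by apply: monic_is_iso => //; rewrite mdim_simple; apply/is_zero_mdim.
by rewrite fE; apply: epic_comp.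
Qed.

Lemma brick_simple k : brick (simple P k).
Proof.
split=> [/jid0_is_zero|f /to_simple_epic ef]; first exact: simple_nonzero.
have [L [i fi]] := short_exact_epic ef.
apply/is_iso_monic_epic; split=> //; have [_ /exact_atP fiP _] := fi.
have L0 : is_zero L.
  by have /eqP := short_exact_mdim fi; rewrite mdim_simple addn1 eqSS => /eqP/esym.
by apply: monic_eq0 => v /fiP[u ->]; move/is_zeroP: L0 => L0; rewrite (L0 u) linear0.
Qed.

Lemma minimal_submodule X : ~ is_zero X ->
  exists L (i : jhom L X), [/\ monic i, ~ is_zero L &
    forall L' (j : jhom L' L), monic j -> ~ is_zero L' -> is_iso j].
Proof.
have [d] := ubnP (mdim X); elim: d X => // d IH X dX X0.
have [Xmin|Xnmin] :=
    pselect (forall L' (j : jhom L' X), monic j -> ~ is_zero L' -> is_iso j).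
  exists X, (jid X); split=> //.
  by have /is_iso_monic_epic[] : is_iso (jid X) by exists (jid X); rewrite jcomp1l.
have /existsNP[L /existsNP[j /not_implyP[mj /not_implyP[L0 nij]]]] := Xnmin.
have [|L' [i [mi L'0 L'min]]] := IH L _ L0.
  move: dX; rewrite ltnS; apply: leq_trans; rewrite ltnNge; apply/negP.
  by move/(monic_is_iso mj).
by exists L', (jcomp j i); split=> //; apply: monic_comp.
Qed.

Lemma minimal_to_simple k L (f : jhom L (simple P k)) :
  (forall L' (j : jhom L' L), monic j -> ~ is_zero L' -> is_iso j) ->
  f <> 0 -> iso L (simple P k).
Proof.
move=> Lmin f0; have [L' [j jf]] := short_exact_epic (to_simple_epic f0).
apply: (short_exact_zerol jf); apply: contrapT => L'0.
have [mj fj _] := jf; have /is_iso_monic_epic[_ ej] := Lmin L' j mj L'0.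
exact/f0/(epic_comp_eq0 ej)/exact_comp0.
Qed.

End SimpleModules.

Section Equivalence.
Set Implicit Arguments.
Unset Strict Implicit.
Variables (K : fieldType) (n : nat) (P P' : qpot K n).
Variables (F : additive_functor P P') (G : additive_functor P' P).

Lemma fmap0 X Y : fmap F (0 : jhom X Y) = 0.
Proof. by apply: (@addrI _ (fmap F 0)); rewrite -fmap_add !addr0. Qed.

Lemma fmap_iso X Y (f : jhom X Y) : is_iso f -> is_iso (fmap F f).
Proof.
by move=> [g [gf fg]]; exists (fmap F g); rewrite -!fmap_comp gf fg !fmap_id.
Qed.

Lemma fobj_zero X : is_zero X -> is_zero (F X).
Proof.
by move=> /jid0_is_zero X0; apply/jid0_is_zero; rewrite -fmap_id X0 fmap0.
Qed.

Variable T : subcat P.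
Hypothesis GF : retracts_on T F G.

(** [G] recovers [f] from [fmap F f], up to the isomorphisms [eta]. *)
Lemma fmap_faithful X Y (f g : jhom X Y) : T X -> T Y ->
  fmap F f = fmap F g -> f = g.
Proof.
move=> TX TY fg; have [eta [eta_iso eta_nat]] := GF.
have /is_iso_monic_epic[/monicP meta _] := eta_iso Y TY.
apply: jhom_ext => v; apply: meta; rewrite -!jcompE.
by rewrite (eta_nat _ _ f) // (eta_nat _ _ g) // fg.
Qed.

Lemma hom_zero_reflect X Y : T X -> T Y -> hom_zero (F X) (F Y) -> hom_zero X Y.
Proof.
by move=> TX TY FXY f; apply: fmap_faithful => //; rewrite fmap0; apply: FXY.
Qed.

End Equivalence.

Section FullyFaithful.
Set Implicit Arguments.
Unset Strict Implicit.
Variables (K : fieldType) (n : nat) (P P' : qpot K n).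
Variables (F : additive_functor P P') (G : additive_functor P' P).
Variables (T : subcat P) (T' : subcat P').
Hypotheses (GF : retracts_on T F G) (FG : retracts_on T' G F).
Hypothesis (FT : forall X, T X -> T' (F X)).

(** The preimage of [h] is [fmap G h] read through the isomorphisms [X ~ G (F X)]; that
    it is mapped to [h] is checked after applying the faithful functor [G]. *)
Lemma fmap_full X Y (h : jhom (F X) (F Y)) : T X -> T Y ->
  exists f : jhom X Y, fmap F f = h.
Proof.
move=> TX TY; have [eta [eta_iso eta_nat]] := GF.
have [u [uY Yu]] := eta_iso Y TY.
have /is_iso_monic_epic[_ eX] := eta_iso X TX.
exists (jcomp u (jcomp (fmap G h) (eta X))).
apply: (fmap_faithful FG (FT TX) (FT TY)); apply: jhom_ext => v.
have [x ->] := proj1 (epicP _) eX v; rewrite -!jcompE -eta_nat //.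
by rewrite jcompA Yu jcomp1l.
Qed.

Lemma hom_zero_preserve X Y : T X -> T Y -> hom_zero X Y -> hom_zero (F X) (F Y).
Proof.
by move=> TX TY XY h; have [f <-] := fmap_full h TX TY; rewrite (XY f) fmap0.
Qed.

Lemma brick_preserve X : T X -> brick X -> brick (F X).
Proof.
move=> TX [X0 Xb]; split=> [FX0|h h0].
  by apply/X0/(fmap_faithful GF TX TX); rewrite fmap0 fmap_id.
have [f fE] := fmap_full h TX TX; rewrite -fE; apply/fmap_iso/Xb => f0.
by apply: h0; rewrite -fE f0 fmap0.
Qed.

End FullyFaithful.

(** * Reflection of complete forward hom-orthogonal sequences *)

Section ReflectedSequence.
Set Implicit Arguments.
Unset Strict Implicit.
Variables (K : fieldType) (n : nat) (P P' : qpot K n) (k : 'I_n).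
Variables (Fp : additive_functor P P') (Fm : additive_functor P' P).
Hypothesis hF : reflection_functors k Fp Fm.
Variables (N1 : jmod P) (Ns : seq (jmod P)).
Hypotheses (cfhoN : complete_fho (N1 :: Ns)) (isoN1 : iso N1 (simple P k)).

Local Notation S := (simple P k).
Local Notation S' := (simple P' k).
Local Notation Ns' := (rcons [seq Fp N | N <- Ns] S').

Lemma tail_perp i : (i < size Ns)%N -> right_perp S (nth_mod Ns i).
Proof.
move=> iN; have [_ fhoN _ _] := cfhoN.
exact: hom_zero_iso isoN1 (iso_refl _) (fhoN 0%N i.+1 iN).
Qed.

Lemma size_reflected : size Ns' = (size Ns).+1.
Proof. by rewrite size_rcons size_map. Qed.

Lemma nth_reflected i : (i < size Ns)%N -> nth_mod Ns' i = Fp (nth_mod Ns i).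
Proof.
by move=> iN; rewrite /nth_mod nth_rcons size_map iN (nth_map (zero_mod P)).
Qed.

Lemma nth_reflected_last : nth_mod Ns' (size Ns) = S'.
Proof. by rewrite /nth_mod nth_rcons size_map ltnn eqxx. Qed.

Lemma hom_zero_reflected_to i X : (i < size Ns)%N -> left_perp S' X ->
  hom_zero (Fp (nth_mod Ns i)) X -> hom_zero (nth_mod Ns i) (Fm X).
Proof.
move=> iN SX NX; apply: (hom_zero_reflect (refl_mp hF)); first exact: tail_perp.
  exact: refl_perp_m hF _ SX.
have [eta [eta_iso _]] := refl_pm hF.
by apply: hom_zero_iso (iso_refl _) _ NX; exists (eta X); apply: eta_iso.
Qed.

Lemma hom_zero_reflected_from i X : (i < size Ns)%N -> left_perp S' X ->
  hom_zero X (Fp (nth_mod Ns i)) -> hom_zero (Fm X) (nth_mod Ns i).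
Proof.
move=> iN SX NX; apply: (hom_zero_reflect (refl_mp hF)).
- exact: refl_perp_m hF _ SX.
- exact: tail_perp.
have [eta [eta_iso _]] := refl_pm hF.
by apply: hom_zero_iso _ (iso_refl _) NX; exists (eta X); apply: eta_iso.
Qed.

(** A minimal submodule [L] of a nonzero [Y] either has a nonzero map to [S'], and is
    then isomorphic to [S'], or is the reflection of [Fm L], which receives no nonzero
    map from [N1 :: Ns] and therefore vanishes. Both are absurd. *)
Lemma reflected_generates Y :
  (forall i, hom_zero (nth_mod Ns' i) Y) -> is_zero Y.
Proof.
move=> NY; apply: contrapT => Y0.
have [L [i [mi L0 Lmin]]] := minimal_submodule Y0.
have [LS|/existsNP[f f0]] := pselect (hom_zero L S'); last first.
  have [g /is_iso_monic_epic[_ eg]] := iso_sym (minimal_to_simple Lmin f0).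
  have := NY (size Ns); rewrite nth_reflected_last => SY.
  have i0 : i = 0 := epic_comp_eq0 eg (SY (jcomp i g)).
  by apply/L0/jid0_is_zero/(monic_comp_eq0 mi); rewrite i0 jcomp0l.
have V0 : is_zero (Fm L).
  apply: (tors_torf_zero (Ms := N1 :: Ns) (i := (size Ns).+1)).
    by apply: tors_all.
  move=> [_|j].
    exact: hom_zero_iso (iso_sym isoN1) (iso_refl _) (refl_perp_m hF LS).
  rewrite ltnS => jN; apply: hom_zero_reflected_to => // h.
  by apply: (monic_comp_eq0 mi); have := NY j; rewrite nth_reflected //; apply.
have [eta [eta_iso _]] := refl_pm hF.
apply/L0/(iso_is_zero _ (fobj_zero Fp V0)); apply: iso_sym.
by exists (eta L); apply: eta_iso.
Qed.

(** A brick inserted before [S'] lies in the left orthogonal of [S'], so it comes from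
    a brick that can be inserted at the corresponding place of [N1 :: Ns], one step
    further because of [N1]. A brick inserted after [S'] receives no nonzero map from
    the sequence, and [reflected_generates] applies. *)
Lemma reflected_cfho : complete_fho Ns'.
Proof.
have [bN fhoN maxN genN] := cfhoN.
have perpT X := @refl_perp_p _ _ _ _ _ _ _ hF X.
have perpT' Y := @refl_perp_m _ _ _ _ _ _ _ hF Y.
split.
- move=> i; rewrite size_reflected ltnS leq_eqVlt => /predU1P[->|iN].
    by rewrite nth_reflected_last; apply: brick_simple.
  rewrite nth_reflected //; apply: (brick_preserve (refl_mp hF) (refl_pm hF) perpT).
    exact: tail_perp.
  exact: (bN i.+1).
- move=> i j /andP[ij]; rewrite size_reflected ltnS leq_eqVlt => /predU1P[jE|jN].
    by subst j; rewrite nth_reflected_last nth_reflected //; apply/perpT/tail_perp.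
  have iN := ltn_trans ij jN; rewrite !nth_reflected //.
  apply: (hom_zero_preserve (refl_mp hF) (refl_pm hF) perpT); try exact: tail_perp.
  by apply: (fhoN i.+1 j.+1); rewrite /= !ltnS ij.
- move=> X bX _ j jN' XN; have [_ NX XN'] := fho_insertE jN' XN.
  move: jN'; rewrite size_reflected leq_eqVlt => /predU1P[jE|jN].
    apply/(brick_nonzero bX)/reflected_generates => i.
    have [iN|Ni] := ltnP i j; first exact: NX.
    rewrite nth_mod_default ?size_reflected -?jE //.
    exact/hom_zero_from0/is_zero_zero_mod.
  rewrite ltnS in jN; have XS : left_perp S' X.
    by rewrite /left_perp -nth_reflected_last; apply: XN'; rewrite jN size_reflected /=.
  have bV : brick (Fm X) := brick_preserve (refl_pm hF) (refl_mp hF) perpT' XS bX.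
  apply: (maxN _ bV (genN _) j.+1 jN); apply: fho_insert => //.
    move=> [_|i]; first exact: hom_zero_iso (iso_sym isoN1) (iso_refl _) (perpT' _ XS).
    rewrite ltnS => ij; have iN := leq_trans ij jN.
    by apply: hom_zero_reflected_to => //; have := NX i ij; rewrite nth_reflected.
  move=> [//|i] /andP[ij iN]; apply: hom_zero_reflected_from => //.
  have := XN' i; rewrite nth_reflected // size_reflected; apply.
  by rewrite -ltnS ij ltnW.
- move=> X Y NY; apply/hom_zero_to0/reflected_generates => i.
  by move/hom_zero_direct_sum: NY; apply.
Qed.

End ReflectedSequence.

(** * Reflection of central charges *)

Section ReflectedCharge.
Set Implicit Arguments.
Unset Strict Implicit.
Variables (n : nat) (Q : quiver n) (k : 'I_n).

Lemma reflection_matrixK (A : pzRingType) :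
  reflection_matrix A Q k *m reflection_matrix A Q k = 1%:M.
Proof.
apply/matrixP => i j; rewrite mxE.
have rowE l : l != k -> reflection_matrix A Q k l j = (l == j)%:R.
  by move=> lk; rewrite mxE (negPf lk).
have [->|ik] := eqVneq i k; last first.
  rewrite (bigD1 i) //= [X in X * _]mxE (negPf ik) eqxx mul1r rowE //.
  rewrite big1 ?addr0 ?mxE // => l li.
  by rewrite [X in X * _]mxE (negPf ik) eq_sym (negPf li) mul0r.
rewrite (bigD1 k) //= [X in X * _]mxE !eqxx mulN1r.
have [jk|jk] := eqVneq j k.
  subst j; rewrite big1 ?addr0 => [|l lk]; last by rewrite rowE // (negPf lk) mulr0.
  by rewrite !mxE !eqxx opprK.
rewrite (bigD1 j) //= (rowE j jk) eqxx mulr1 addrA addNr add0r.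
rewrite big1 ?mxE 1?eq_sym ?(negPf jk) // => l /andP[lk lj].
by rewrite rowE // (negPf lj) mulr0.
Qed.

Variable R : realType.

Lemma pairingE (theta : 'cV[R]_n) d :
  pairing theta d = (theta^T *m map_mx intr d) 0 0.
Proof. by rewrite mxE; apply: eq_bigr => i _; rewrite !mxE. Qed.

Lemma map_reflection_matrix :
  map_mx intr (reflection_matrix int Q k) = reflection_matrix R Q k.
Proof.
apply/matrixP => i j; rewrite !mxE; case: eqP => _; last by rewrite rmorph_nat.
by case: eqP => _; rewrite ?rmorphN1 ?rmorph_nat.
Qed.

Lemma pairing_reflection (theta : 'cV[R]_n) d :
  pairing ((reflection_matrix R Q k)^T *m theta) (reflection_matrix int Q k *m d) =
  pairing theta d.
Proof.
rewrite !pairingE trmx_mul trmxK map_mxM map_reflection_matrix -!mulmxA.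
by rewrite (mulmxA (reflection_matrix R Q k)) reflection_matrixK mul1mx.
Qed.

Lemma pairing_reflection_simple (theta : 'cV[R]_n) :
  pairing ((reflection_matrix R Q k)^T *m theta) (delta_mx k 0) =
  - pairing theta (delta_mx k 0).
Proof.
rewrite !pairingE trmx_mul trmxK map_delta_mx -mulmxA.
have -> : reflection_matrix R Q k *m delta_mx k 0 = - delta_mx k 0 :> 'cV[R]_n.
  rewrite -colE; apply/matrixP => i j; rewrite !mxE (ord1 j) !eqxx andbT.
  by case: eqP => // _; rewrite oppr0.
by rewrite mulmxN [LHS]mxE.
Qed.

End ReflectedCharge.

Theorem corollary4p7 (R : realType) (K : fieldType) (n : nat)
    (P P' : qpot K n) (k : 'I_n)
    (hP : nondegenerate_qp P) (hP' : is_mutation k P P')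
    (fdP : finite_dimensional P) (fdP' : finite_dimensional P')
    (Fp : additive_functor P P') (Fm : additive_functor P' P)
    (hF : reflection_functors k Fp Fm)
    (N1 : jmod P) (Ns : seq (jmod P))
    (hN : complete_fho (N1 :: Ns)) (hN1 : iso N1 (simple P k))
    (alpha beta : 'cV[R]_n)
    (hbeta : forall i, 0 < ((reflection_matrix R P k)^T *m beta) i 0)
    (hslope : sorted <%R
       [seq pairing alpha (dim_vector N) / pairing beta (dim_vector N) | N <- rcons Ns N1]) :
  let Ns' := rcons [seq Fp N | N <- Ns] (simple P' k) in
  let Z := CentralCharge ((reflection_matrix R P k)^T *m alpha) hbeta in
  complete_fho Ns' /\ mgs_induced_by (size Ns') (mgs_of Ns') Z.
Proof.
move=> Ns' Z; have cfhoNs' : complete_fho Ns' := reflected_cfho hF hN hN1.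
split=> //; apply: mgs_of_induced => // i j /andP[ij]; rewrite size_reflected => jN.
pose f (N : jmod P) := pairing alpha (dim_vector N) / pairing beta (dim_vector N).
have slopeE l : (l <= size Ns)%N ->
    slope Z (nth_mod Ns' l) = nth 0 [seq f N | N <- rcons Ns N1] l.
  move=> lN; rewrite (nth_map (zero_mod P)) ?size_rcons // nth_rcons /slope /=.
  move: lN; rewrite leq_eqVlt => /predU1P[->|lN].
    (* Both numerator and denominator change sign at the last place. *)
    rewrite ltnn eqxx nth_reflected_last dim_vector_simple !pairing_reflection_simple.
    by rewrite /f (dim_vector_iso hN1) dim_vector_simple invrN mulrNN.
  rewrite lN nth_reflected // (refl_dim hF); last exact: (tail_perp hN hN1).
  by rewrite !pairing_reflection.
rewrite !slopeE //; last by rewrite -ltnS (ltn_trans ij).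
apply: (sorted_ltn_nth lt_trans) => //; rewrite inE size_map size_rcons //.
exact: ltn_trans ij jN.
Qed.
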